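(* Let $P$ be the marginal Metropolis--Hastings kernel with target $\pi$ and proposal $q$, and let $\tilde P$ be the associated pseudo-marginal kernel with weight distributions $\{Q_x\}_{x\in\mathsf X}$. Assume $\operatorname{Gap}(P)>0$ and that there exists $\bar w\in[1,\infty)$ such that $Q_x([0,\bar w])=1$ for $\pi$-almost every $x\in\mathsf X$. Let $g:\mathsf X\to\mathbb R$ satisfy $\pi(g^2)<\infty$. Then the asymptotic variances satisfy $$\operatorname{var}(g,P)\le\operatorname{var}(g,\tilde P)\le\bar w\operatorname{var}(g,P)+(\bar w-1)\operatorname{var}_\pi(g),$$ where $\operatorname{var}(g,\tilde P):=\operatorname{var}(\tilde g,\tilde P)$ with $\tilde g(x,w)=g(x)$ for all $(x,w)$.
   Context: Let $(\mathsf X,\mathcal B(\mathsf X))$ be a measurable space, $\pi$ a probability measure on it and $q(x,\mathrm dy)$ a Markov kernel on $\mathsf X$. The function $r(x,y)=\frac{\pi(\mathrm dy)q(y,\mathrm dx)}{\pi(\mathrm dx)q(x,\mathrm dy)}$ is the Radon--Nikodym derivative in the sense of Tierney: there is a symmetric measurable set $R\subset\mathsf X^2$ on which the measures $\pi(\mathrm dx)q(x,\mathrm dy)$ and $\pi(\mathrm dy)q(y,\mathrm dx)$ are mutually absolutely continuous, and on whose complement they are mutually singular; on $R$, $r$ is the density of the second with respect to the first, with values in $(0,\infty)$ and $r(x,y)r(y,x)=1$; off $R$, $r:=0$. The marginal kernel is $P(x,\mathrm dy)=\min\{1,r(x,y)\}q(x,\mathrm dy)+\delta_x(\mathrm dy)\rho(x)$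 with $\rho(x)=1-\int\min\{1,r(x,y)\}q(x,\mathrm dy)$. Let $\mathsf W$ be a Borel subset of $\mathbb R_+=[0,\infty)$ and let $x\mapsto Q_x$ be a probability kernel from $\mathsf X$ to $\mathsf W$ with $\int w\,Q_x(\mathrm dw)=1$ for all $x$. Put $\pi_x(\mathrm dw)=w\,Q_x(\mathrm dw)$ and $\tilde\pi(\mathrm dx,\mathrm dw)=\pi(\mathrm dx)\pi_x(\mathrm dw)$. The pseudo-marginal kernel is $\tilde P(x,w;\mathrm dy,\mathrm du)=\min\{1,r(x,y)\frac uw\}q(x,\mathrm dy)Q_y(\mathrm du)+\delta_{x,w}(\mathrm dy,\mathrm du)\tilde\rho(x,w)$ with $\tilde\rho(x,w)=1-\iint\min\{1,r(x,y)\frac uw\}q(x,\mathrm dy)Q_y(\mathrm du)$; it is reversible with respect to $\tilde\pi$. (If $0\in\mathsf W$, read $\min\{1,r(x,y)u/w\}$ as $1$ for $w=0$; the set $\{w=0\}$ is $\tilde\pi$-null.) For a Markov kernel $\Pi$ reversible with respect to a probability $\mu$: $\operatorname{var}_\mu(g)=\mu((g-\mu(g))^2)$; $\mathcal E_\Pi(g)=\langle g,(I-\Pi)g\rangle_\mu=\frac12\int\mu(\mathrm dx)\Pi(x,\mathrm dy)[g(x)-g(y)]^2$; $\operatorname{Gap}(\Pi)=\inf\{\mathcal E_\Pi(g)/\operatorname{var}_\mu(g):\mu(g^2)<\infty,\operatorname{var}_\mu(g)>0\}$. For $f$ with $\mu(f^2)<\infty$ and $(X_k)_{k\ge0}$ the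 stationary chain with kernel $\Pi$ and $X_0\sim\mu$, the asymptotic variance is $\operatorname{var}(f,\Pi):=\lim_{n\to\infty}\frac1n\mathbb E\bigl(\sum_{k=1}^n (f(X_k)-\mu(f))\bigr)^2\in[0,\infty]$ (the limit always exists). *)

(* Defs.v *)
From HB Require Import structures.
From mathcomp Require Import all_boot all_order all_algebra.
From mathcomp Require Import all_classical all_reals all_analysis.
From mathcomp Require Import measurable_realfun.

Set Implicit Arguments.
Unset Strict Implicit.
Unset Printing Implicit Defensive.
Import Order.TTheory GRing.Theory Num.Theory.
Import numFieldNormedType.Exports.
Local Open Scope classical_set_scope.
Local Open Scope ring_scope.
Local Open Scope ereal_scope.

Section semidirect.
Context d d' (X : measurableType d) (Y : measurableType d') (R : realType).
Variables (mu : {measure set X -> \bar R}) (k : R.-pker X ~> Y).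

(* The joint law mu(dx) k(x, dy). *)
Definition semidirect (A : set (X * Y)) : \bar R :=
  \int[mu]_x k x (xsection A x).

Let semidirect0 : semidirect set0 = 0.
Proof. by apply: integral0_eq => x _; rewrite xsection0 measure0. Qed.

Let semidirect_ge0 A : 0 <= semidirect A.
Proof. exact: integral_ge0. Qed.

Let semidirect_sigma_additive : semi_sigma_additive semidirect.
Proof.
move=> F mF tF mUF.
rewrite [X in _ --> X](_ : _ = \sum_(n <oo) semidirect (F n)); last first.
  rewrite /semidirect -integral_nneseries//; last first.
    by move=> n; apply: measurable_fun_xsection_finite_kernel; rewrite inE.
  apply: eq_integral => x _; rewrite xsection_bigcup.
  rewrite measure_semi_bigcup//.
  - by move=> n; exact: measurable_xsection.
  - exact: trivIset_xsection.
  - by apply: bigcup_measurable => n _; exact: measurable_xsection.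
apply/cvg_closeP; split; last by rewrite closeE.
by apply: is_cvg_nneseries => n _ _; exact: semidirect_ge0.
Qed.

HB.instance Definition _ := isMeasure.Build _ _ _ semidirect
  semidirect0 semidirect_ge0 semidirect_sigma_additive.

End semidirect.

Section semidirect_probability.
Context d d' (X : measurableType d) (Y : measurableType d') (R : realType).
Variables (mu : probability X R) (k : R.-pker X ~> Y).

Let semidirectT : semidirect mu k setT = 1.
Proof.
rewrite /semidirect (eq_integral (cst 1)); last first.
  by move=> x _; rewrite xsectionE preimage_setT prob_kernel.
by rewrite integral_cst//= mul1e probability_setT.
Qed.

HB.instance Definition _ := Measure_isProbability.Build _ _ _
  (semidirect mu k) semidirectT.

End semidirect_probability.

Section kdensity.
Context d d' (X : measurableType d) (Y : measurableType d') (R : realType).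
Variables (k : R.-pker X ~> Y) (f : X * Y -> R).

(* The kernel f(x, y) k(x, dy); the two proof arguments are what makes it a
   family of measures, as in kdirac. *)
Definition kdensity (mf : measurable_fun [set: X * Y] f)
    (f0 : forall z, (0 <= f z)%R) (x : X) (A : set Y) : \bar R :=
  \int[k x]_(y in A) (f (x, y))%:E.

Hypotheses (mf : measurable_fun [set: X * Y] f) (f0 : forall z, (0 <= f z)%R).

Let mfx x : measurable_fun [set: Y] (fun y => (f (x, y))%:E).
Proof. by apply/measurable_EFinP; exact: measurable_fun_pair2. Qed.

Let kdensity0 x : kdensity mf f0 x set0 = 0.
Proof. exact: integral_set0. Qed.

Let kdensity_ge0 x A : 0 <= kdensity mf f0 x A.
Proof. by apply: integral_ge0 => y _; rewrite lee_fin. Qed.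

Let kdensity_sigma_additive x : semi_sigma_additive (kdensity mf f0 x).
Proof.
move=> F mF tF mUF.
rewrite [X in _ --> X](_ : _ = \sum_(n <oo) kdensity mf f0 x (F n)); last first.
  rewrite /kdensity ge0_integral_bigcup//.
  - exact: measurable_funTS.
  - by move=> y _; rewrite lee_fin.
apply/cvg_closeP; split; last by rewrite closeE.
by apply: is_cvg_nneseries => n _ _; exact: kdensity_ge0.
Qed.

HB.instance Definition _ x := isMeasure.Build _ _ _ (kdensity mf f0 x)
  (kdensity0 x) (kdensity_ge0 x) (@kdensity_sigma_additive x).

Definition mkdensity : X -> {measure set Y -> \bar R} := kdensity mf f0.

Let measurable_mkdensity U :
  measurable U -> measurable_fun [set: X] (mkdensity ^~ U).
Proof.
move=> mU.
rewrite (_ : (fun _ => _) = (fun x =>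
    \int[k x]_y ((f (x, y) * \1_U y)%:E))); last first.
  apply/funext => x; rewrite /mkdensity /kdensity [LHS]integral_mkcond.
  apply: eq_integral => y _; rewrite patchE indicE.
  by case: ifPn; rewrite ?mulr1 ?mulr0.
have mg : measurable_fun [set: X * Y] (fun z => (f z * \1_U z.2)%:E).
  apply/measurable_EFinP; apply: measurable_funM => //.
  by apply: measurableT_comp => //; exact: measurable_indic.
have g0 z : 0 <= (f z * \1_U z.2)%:E by rewrite lee_fin mulr_ge0.
exact: (measurable_fun_integral_sfinite_kernel _ k g0 mg).
Qed.

HB.instance Definition _ :=
  isKernel.Build _ _ _ _ _ mkdensity measurable_mkdensity.

End kdensity.

Section metropolis_hastings.
Context d (T : measurableType d) (R : realType).

Record acceptance := Acceptance {
  accept_prob :> T * T -> R ;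
  measurable_accept : measurable_fun [set: T * T] accept_prob ;
  accept_ge0 : forall z, (0 <= accept_prob z)%R ;
  accept_le1 : forall z, (accept_prob z <= 1)%R }.

Variables (k : R.-pker T ~> T) (a : acceptance).

Definition rejection (x : T) : \bar R := 1 - \int[k x]_y (a (x, y))%:E.

(* The kernel a(x, y) k(x, dy) + delta_x(dy) rho(x), with rho = rejection. *)
Definition mh_measure (x : T) (A : set T) : \bar R :=
  \int[k x]_(y in A) (a (x, y))%:E + rejection x * \d_x A.

Let mhE x : mh_measure x = fun A =>
  kdensity k (measurable_accept a) (accept_ge0 a) x A + rejection x * \d_x A.
Proof. by []. Qed.

Let kdensity_le1 x : \int[k x]_y (a (x, y))%:E <= 1.
Proof.
rewrite -(prob_kernel (s := k) x) -[leRHS]mul1e -(integral_cst (k x) measurableT).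
apply: ge0_le_integral => //.
- by move=> y _; rewrite lee_fin accept_ge0.
- apply/measurable_EFinP; apply: measurable_fun_pair2.
  exact: measurable_accept.
- by move=> y _; rewrite lee_fin accept_le1.
Qed.

Let integral_fin x : \int[k x]_y (a (x, y))%:E \is a fin_num.
Proof.
rewrite ge0_fin_numE; last by apply: integral_ge0 => y _; rewrite lee_fin accept_ge0.
by rewrite (le_lt_trans (kdensity_le1 x))// ltry.
Qed.

Let rejection_ge0 x : 0 <= rejection x.
Proof. by rewrite /rejection sube_ge0 ?kdensity_le1 ?integral_fin. Qed.

Let rejection_fin x : rejection x \is a fin_num.
Proof. by rewrite /rejection fin_numB integral_fin. Qed.

Let mh0 x : mh_measure x set0 = 0.
Proof. by rewrite mhE !measure0 mule0 adde0. Qed.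

Let mh_ge0 x A : 0 <= mh_measure x A.
Proof. by rewrite mhE adde_ge0// mule_ge0. Qed.

Let mh_sigma_additive x : semi_sigma_additive (mh_measure x).
Proof.
move=> F mF tF mUF.
rewrite [X in _ --> X](_ : _ = \sum_(n <oo) mh_measure x (F n)); last first.
  rewrite mhE nneseriesD//; last by move=> n _ _; rewrite mule_ge0.
  rewrite -(fineK (rejection_fin x)) nneseriesZl//.
  congr (_ + _ * _); exact: (measure_semi_bigcup _ mF tF mUF).
apply/cvg_closeP; split; last by rewrite closeE.
by apply: is_cvg_nneseries => n _ _; exact: mh_ge0.
Qed.

HB.instance Definition _ x := isMeasure.Build _ _ _ (mh_measure x)
  (mh0 x) (mh_ge0 x) (@mh_sigma_additive x).

Definition mh_kernel : T -> {measure set T -> \bar R} := mh_measure.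

Let measurable_mh_kernel U :
  measurable U -> measurable_fun [set: T] (mh_kernel ^~ U).
Proof.
move=> mU.
have mK V : measurable V -> measurable_fun [set: T] (fun x =>
    \int[k x]_(y in V) (a (x, y))%:E).
  move=> mV; exact: (measurable_kernel
    (mkdensity k (measurable_accept a) (accept_ge0 a)) V mV).
apply: emeasurable_funD; first exact: mK.
apply: emeasurable_funM.
  by apply: emeasurable_funB => //; exact: mK.
by apply/measurable_EFinP; exact: measurable_indic.
Qed.

HB.instance Definition _ :=
  isKernel.Build _ _ _ _ _ mh_kernel measurable_mh_kernel.

Let mh_kernelT x : mh_kernel x setT = 1.
Proof.
by rewrite /mh_kernel /= /mh_measure diracT mule1 /rejection addeC subeK.
Qed.

HB.instance Definition _ :=
  Kernel_isProbability.Build _ _ _ _ _ mh_kernel mh_kernelT.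

End metropolis_hastings.

Section marginal.
Context d (X : measurableType d) (R : realType).
Variables (pi : probability X R) (q : R.-pker X ~> X).

(* pi(dx) q(x, dy) and pi(dy) q(y, dx), as measures in (x, y). *)
Definition forward_flow : set (X * X) -> \bar R := semidirect pi q.
Definition backward_flow : set (X * X) -> \bar R :=
  pushforward (semidirect pi q) (fun z : X * X => (z.2, z.1)).

(* The ratio pi(dy) q(y, dx) / (pi(dx) q(x, dy)) in the sense of Tierney. *)
Record mh_ratio := MhRatio {
  ratio :> X * X -> R ;
  ratio_set : set (X * X) ;
  measurable_ratio : measurable_fun [set: X * X] ratio ;
  measurable_ratio_set : measurable ratio_set ;
  ratio_set_sym : forall x y, ratio_set (x, y) -> ratio_set (y, x) ;
  ratio_set_ac : forall A, measurable A -> A `<=` ratio_set ->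
    forward_flow A = 0 <-> backward_flow A = 0 ;
  ratio_setC_singular : exists B, [/\ measurable B, B `<=` ~` ratio_set,
    forward_flow B = 0 & backward_flow (~` ratio_set `\` B) = 0] ;
  ratio_gt0 : forall z, ratio_set z -> (0 < ratio z)%R ;
  ratio_inv : forall x y, ratio_set (x, y) ->
    (ratio (x, y) * ratio (y, x) = 1)%R ;
  ratio_density : forall A, measurable A -> A `<=` ratio_set ->
    backward_flow A = \int[semidirect pi q]_(z in A) (ratio z)%:E ;
  ratio_off : forall z, ~ ratio_set z -> ratio z = 0%R }.

Lemma ratio_ge0 (r : mh_ratio) z : (0 <= r z)%R.
Proof.
by have [/ratio_gt0/ltW//|/ratio_off->] := pselect (ratio_set r z).
Qed.

Variable r : mh_ratio.

Definition marginal_accept (z : X * X) : R := Num.min 1%R (r z).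

Let measurable_marginal_accept :
  measurable_fun [set: X * X] marginal_accept.
Proof. by apply: measurable_minr => //; exact: measurable_ratio. Qed.

Let marginal_accept_ge0 z : (0 <= marginal_accept z)%R.
Proof. by rewrite le_min ler01 ratio_ge0. Qed.

Let marginal_accept_le1 z : (marginal_accept z <= 1)%R.
Proof. by rewrite ge_min lexx. Qed.

Definition marginal_acceptance : acceptance X R :=
  Acceptance measurable_marginal_accept marginal_accept_ge0
    marginal_accept_le1.

Definition marginal_kernel : R.-pker X ~> X :=
  mh_kernel q marginal_acceptance.

End marginal.

Section weights.
Context (R : realType) (W : set R) (Wn0 : W !=set0).

(* The set W as a type, with the trace of the Borel sigma-algebra of R. *)
Definition weight_sub : Type := W.

Let weight_point : weight_sub := SigSub (mem_set (projT2 (cid Wn0))).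

HB.instance Definition _ := Choice.on weight_sub.
HB.instance Definition _ := isPointed.Build weight_sub weight_point.

Definition weight_sub_val (w : weight_sub) : R := val w.

Definition weight := g_sigma_algebra_preimageType weight_sub_val.

HB.instance Definition _ := Measurable.on weight.

Definition wval (w : weight) : R := weight_sub_val w.

Lemma measurable_wval : measurable_fun [set: weight] wval.
Proof. by move=> _ B mB; exists B. Qed.

Lemma wvalP (w : weight) : W (wval w).
Proof. exact: set_mem (valP w). Qed.

End weights.

Lemma measurable_invr (R : realType) :
  measurable_fun [set: R] (fun x : R => (x^-1)%R).
Proof.
have -> : [set: R] = [set 0%R] `|` ~` [set 0%R] by rewrite setUv.
apply/measurable_funU => //; first exact: measurableC.
split; first exact: measurable_fun_set1.
apply: open_continuous_measurable_fun.
  by apply: closed_openC; exact: closed_eq.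
by move=> x; rewrite inE /= => /eqP x0; exact: inv_continuous.
Qed.

Section pseudo_marginal.
Context d (X : measurableType d) (R : realType).
Variables (pi : probability X R) (q : R.-pker X ~> X) (r : mh_ratio pi q).
Variables (W : set R) (Wn0 : W !=set0) (W_ge0 : W `<=` [set w | (0 <= w)%R]).
Variable Q : R.-pker X ~> weight Wn0.

(* q(x, dy) Q_y(du), from the state z = (x, w). *)
Definition pm_proposal (z : X * weight Wn0) :
    {measure set (X * weight Wn0) -> \bar R} :=
  semidirect (q z.1) Q.

Let measurable_pm_proposal U : measurable U ->
  measurable_fun [set: X * weight Wn0] (pm_proposal ^~ U).
Proof.
move=> mU.
have mQ : measurable_fun [set: X] (fun y => Q y (xsection U y)).
  by apply: measurable_fun_xsection_finite_kernel; rewrite inE.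
have mint : measurable_fun [set: X] (fun x => \int[q x]_y Q y (xsection U y)).
  apply: measurable_fun_integral_kernel => //; exact: measurable_kernel.
exact: (measurableT_comp mint measurable_fst).
Qed.

HB.instance Definition _ :=
  isKernel.Build _ _ _ _ _ pm_proposal measurable_pm_proposal.

Let pm_proposalT z : pm_proposal z setT = 1.
Proof.
rewrite /pm_proposal /= /semidirect (eq_integral (cst 1)); last first.
  by move=> x _; rewrite xsectionE preimage_setT prob_kernel.
by rewrite integral_cst//= mul1e prob_kernel.
Qed.

HB.instance Definition _ :=
  Kernel_isProbability.Build _ _ _ _ _ pm_proposal pm_proposalT.

Let W_wval_ge0 (w : weight Wn0) : (0 <= wval w)%R.
Proof. by apply: W_ge0; exact: wvalP. Qed.

(* The move is from z.1 = (x, w) to z.2 = (y, u); it is always accepted when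
   w = 0, whereas u / 0 = 0 would make it always rejected. *)
Definition pm_accept (z : (X * weight Wn0) * (X * weight Wn0)) : R :=
  if wval z.1.2 == 0%R then 1%R
  else Num.min 1%R (r (z.1.1, z.2.1) * (wval z.2.2 / wval z.1.2))%R.

Let measurable_pm_accept : measurable_fun setT pm_accept.
Proof.
have mw1 : measurable_fun setT
    (fun z : (X * weight Wn0) * (X * weight Wn0) => wval z.1.2).
  apply: (measurableT_comp (@measurable_wval R W Wn0)).
  exact: (measurableT_comp measurable_snd measurable_fst).
have mw2 : measurable_fun setT
    (fun z : (X * weight Wn0) * (X * weight Wn0) => wval z.2.2).
  apply: (measurableT_comp (@measurable_wval R W Wn0)).
  exact: (measurableT_comp measurable_snd measurable_snd).
have mr : measurable_fun setT
    (fun z : (X * weight Wn0) * (X * weight Wn0) => r (z.1.1, z.2.1)).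
  apply: (measurableT_comp (measurable_ratio r)).
  apply: measurable_fun_pair.
    exact: (measurableT_comp measurable_fst measurable_fst).
  exact: (measurableT_comp measurable_fst measurable_snd).
apply: measurable_fun_ifT => //; first exact: measurable_fun_eqr.
apply: measurable_minr => //; apply: measurable_funM => //.
apply: measurable_funM => //.
exact: (measurableT_comp (@measurable_invr R)).
Qed.

Let pm_accept_ge0 z : (0 <= pm_accept z)%R.
Proof.
rewrite /pm_accept; case: ifP => // _; rewrite le_min ler01/=.
by rewrite mulr_ge0 ?ratio_ge0// divr_ge0.
Qed.

Let pm_accept_le1 z : (pm_accept z <= 1)%R.
Proof. by rewrite /pm_accept; case: ifP => // _; rewrite ge_min lexx. Qed.

Definition pm_acceptance : acceptance (X * weight Wn0)%type R :=
  Acceptance measurable_pm_accept pm_accept_ge0 pm_accept_le1.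

Definition pm_kernel : R.-pker (X * weight Wn0) ~> (X * weight Wn0)%type :=
  mh_kernel pm_proposal pm_acceptance.

Let measurable_snd_wval :
  measurable_fun [set: X * weight Wn0] (fun z => wval z.2).
Proof.
exact: (measurableT_comp (@measurable_wval R W Wn0) measurable_snd).
Qed.

Let snd_wval_ge0 (z : X * weight Wn0) : (0 <= wval z.2)%R.
Proof. by []. Qed.

(* pi_x(dw) = w Q_x(dw) *)
Definition weighted of (forall x, \int[Q x]_w (wval w)%:E = 1) :
  X -> {measure set (weight Wn0) -> \bar R} :=
  mkdensity Q measurable_snd_wval snd_wval_ge0.

Hypothesis Q1 : forall x, \int[Q x]_w (wval w)%:E = 1.

HB.instance Definition _ := Kernel.copy (weighted Q1)
  (mkdensity Q measurable_snd_wval snd_wval_ge0).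

HB.instance Definition _ :=
  Kernel_isProbability.Build _ _ _ _ _ (weighted Q1) Q1.

Definition pm_target : probability (X * weight Wn0)%type R :=
  semidirect pi (weighted Q1).

End pseudo_marginal.

Section chain.
Context d (T : measurableType d) (R : realType).
Variable K : R.-pker T ~> T.

Section step.
Variables (n : nat) (k : R.-pker T ~> n.-tuple T).

Let cons_pair (z : T * n.-tuple T) : n.+1.-tuple T := [tuple of z.1 :: z.2].

Let measurable_cons_pair : measurable_fun setT cons_pair.
Proof. exact: measurable_cons. Qed.

Let measurable_cons_preimage (A : set (n.+1.-tuple T)) :
  measurable A -> measurable (cons_pair @^-1` A).
Proof.
by move=> mA; rewrite -[X in measurable X]setTI; exact: measurable_cons_pair.
Qed.

Definition trajectory_cons (x : T) : set (n.+1.-tuple T) -> \bar R :=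
  pushforward (semidirect (K x) k) (fun z => [tuple of z.1 :: z.2]).

Let trajectory_cons0 x : trajectory_cons x set0 = 0.
Proof. by rewrite /trajectory_cons /pushforward preimage_set0 measure0. Qed.

Let trajectory_cons_ge0 x A : 0 <= trajectory_cons x A.
Proof. exact: measure_ge0. Qed.

Let trajectory_cons_sigma_additive x :
  semi_sigma_additive (trajectory_cons x).
Proof.
move=> F mF tF mUF; rewrite /trajectory_cons /pushforward preimage_bigcup.
apply: measure_semi_sigma_additive.
- by move=> i; exact: measurable_cons_preimage.
- apply/trivIsetP => /= i j _ _ ij; rewrite -preimage_setI.
  by move/trivIsetP : tF => /(_ _ _ _ _ ij) ->//; rewrite preimage_set0.
- by rewrite -preimage_bigcup; exact: measurable_cons_preimage.
Qed.

HB.instance Definition _ x := isMeasure.Build _ _ _ (trajectory_cons x)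
  (trajectory_cons0 x) (trajectory_cons_ge0 x)
  (@trajectory_cons_sigma_additive x).

Definition trajectory_step : T -> {measure set (n.+1.-tuple T) -> \bar R} :=
  trajectory_cons.

Let measurable_trajectory_step U : measurable U ->
  measurable_fun [set: T] (trajectory_step ^~ U).
Proof.
move=> mU.
have mk : measurable_fun [set: T]
    (fun y => k y (xsection (cons_pair @^-1` U) y)).
  apply: measurable_fun_xsection_finite_kernel; rewrite inE.
  exact: measurable_cons_preimage.
by apply: measurable_fun_integral_kernel mk => //; exact: measurable_kernel.
Qed.

HB.instance Definition _ :=
  isKernel.Build _ _ _ _ _ trajectory_step measurable_trajectory_step.

Let trajectory_stepT x : trajectory_step x setT = 1.
Proof.
rewrite /trajectory_step /= /trajectory_cons /pushforward preimage_setT.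
rewrite /semidirect (eq_integral (cst 1)); last first.
  by move=> y _; rewrite xsectionE preimage_setT prob_kernel.
by rewrite integral_cst//= mul1e prob_kernel.
Qed.

HB.instance Definition _ :=
  Kernel_isProbability.Build _ _ _ _ _ trajectory_step trajectory_stepT.

End step.

(* trajectory n x is the law of (X_1, ..., X_n) for the chain with kernel K
   started at X_0 = x. *)
Fixpoint trajectory n : R.-pker T ~> n.-tuple T :=
  match n with
  | 0%N => kdirac (measurable_cst [tuple])
  | n.+1 => trajectory_step (trajectory n)
  end.

Variable mu : probability T R.

(* The law of (X_0, (X_1, ..., X_n)) for X_0 distributed according to mu. *)
Definition chain_law n : probability (T * n.-tuple T)%type R :=
  semidirect mu (trajectory n).

Definition asymptotic_variance (f : T -> R) : \bar R :=
  limn (fun n => (n%:R^-1)%:E * 'E_(chain_law n)[fun z =>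
    ((\sum_(i < n) (f (tnth z.2 i) - fine 'E_mu[f])) ^+ 2)%R]).

Definition energy (f : T -> R) : \bar R :=
  (2^-1)%:E * \int[mu]_x \int[K x]_y ((f x - f y) ^+ 2)%:E.

Definition gap : \bar R :=
  ereal_inf [set energy f / 'V_mu[f] | f in [set f : T -> R |
    [/\ measurable_fun setT f, 'E_mu[fun x => (f x ^+ 2)%R] < +oo & 0 < 'V_mu[f]]]].

End chain.

(* Main.v *)
From HB Require Import structures.
Require Import Defs.
From mathcomp Require Import all_boot all_order all_algebra.
From mathcomp Require Import all_classical all_reals all_analysis.
From mathcomp Require Import measurable_realfun.
From mathcomp Require Import ring lra.

(** Both inequalities are instances of one comparison principle for two
    reversible chains on different state spaces.

    Let Pi be a kernel reversible for mu, acting on L^2(mu), let f be centred,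
    and put c_k = <f, Pi^k f> and E(h) = <h, (I - Pi) h>.  For 0 <= lam < 1 the
    form E_lam(h) = <h, (I - lam Pi) h> = lam E(h) + (1 - lam) |h|^2 is
    positive, and the Abel sum of the correlations is a maximum,

      sum_k lam^k c_k = <f, (I - lam Pi)^-1 f> = sup_h (2 <h, f> - E_lam(h)).

    Suppose that kappa >= 1 and that a map i from L^2(mu_1) to L^2(mu_2)
    satisfies <i h, f_2> = <h, f_1>, |i h|^2 <= kappa |h|^2 and
    E_2(i h) <= kappa E_1(h).  Testing the second supremum with i h / kappa, for
    the h which is optimal in the first one, gives
    sum_k lam^k c_k(f_1) <= kappa sum_k lam^k c_k(f_2); this is
    [resolvent_comparison], where finite sums replace the resolvent so that
    nothing has to converge in L^2.

    The variance of the sum of n steps is 2 T_n - n c_0 with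
    T_n = sum_(m < n) sum_(k <= m) c_k ([chain_law_path_sum_variance]).  The
    quotient T_n / n has a limit in ]-oo, +oo] because c_2k is nonnegative and
    nonincreasing and c_2k + c_(2k+1) >= 0 ([double_sum_cvg]), and the
    inequality between Abel sums passes to these limits
    ([cesaro_comparison]).  The outcome is [asymptotic_var_comparison]:
    var(f_1) <= kappa var(f_2) + (kappa - 1) |f_2|^2 when |f_1| = |f_2|.

    For the pseudo-marginal chain, w min(1, r u / w) = min(w, r u), so that

      2 E(h) = int pi(dx) q(x,dy) int Q_x(dw) Q_y(du)
                 min(w, r u) (h(x,w) - h(y,u))^2.

    - Lower bound: i lifts h(x) to a function of (x, w), and kappa = 1.  The
      mean of min(w, r u) is at most min(1, r) as w and u have mean 1
      ([dirichlet_lift_le]).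
    - Upper bound: i takes h(x, w) to its mean under pi_x, and kappa = wbar.
      By Jensen's inequality (i h(x) - i h(y))^2 is at most the mean of
      w u (h(x,w) - h(y,u))^2, and min(1, r) w u <= wbar min(w, r u) when w and
      u are at most wbar ([dirichlet_condexp_le]). *)

Set Implicit Arguments.
Unset Strict Implicit.
Unset Printing Implicit Defensive.
Import Order.TTheory GRing.Theory Num.Theory.
Import numFieldNormedType.Exports.
Local Open Scope classical_set_scope.
Local Open Scope ring_scope.

(** * Symmetric contractions *)

(** The data of a self-adjoint operator of norm at most one, on a space that
    need be neither complete nor separated: the inner product may vanish on
    nonzero vectors, as it does for functions which are almost everywhere
    zero. Linearity of the operator, up to null vectors, follows from its
    symmetry. *)
Record symContraction (R : realType) := SymContraction {
  carrier :> lmodType R ;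
  ip : carrier -> carrier -> R ;
  sym_op : carrier -> carrier ;
  ip_sym : forall u v, ip u v = ip v u ;
  ip_lin : forall a u v w, ip (a *: u + v) w = a * ip u w + ip v w ;
  sym_op_sym : forall u v, ip (sym_op u) v = ip u (sym_op v) ;
  sym_op_bound : forall u, `|ip u (sym_op u)| <= ip u u }.

Section symmetric_contraction.
Variables (R : realType) (V : symContraction R).
Implicit Types u v w : V.

Lemma ipDl u v w : ip (u + v) w = ip u w + ip v w.
Proof. by rewrite -[u]scale1r ip_lin mul1r scale1r. Qed.

Lemma ip0l w : ip 0 w = 0.
Proof. by have := ipDl 0 0 w; rewrite addr0 => /(congr1 (fun x => x - ip 0 w));
  rewrite addrK subrr. Qed.

Lemma ipZl a u w : ip (a *: u) w = a * ip u w.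
Proof. by rewrite -[a *: u]addr0 ip_lin ip0l addr0. Qed.

Lemma ipDr u v w : ip w (u + v) = ip w u + ip w v.
Proof. by rewrite ip_sym ipDl !(ip_sym w). Qed.

Lemma ipZr a u w : ip w (a *: u) = a * ip w u.
Proof. by rewrite ip_sym ipZl (ip_sym w). Qed.

Lemma ip_suml n (F : nat -> V) w :
  ip (\sum_(i < n) F i) w = \sum_(i < n) ip (F i) w.
Proof.
elim: n => [|n IH]; first by rewrite !big_ord0 ip0l.
by rewrite !big_ord_recr/= ipDl IH.
Qed.

Lemma ip_sumr n (F : nat -> V) w :
  ip w (\sum_(i < n) F i) = \sum_(i < n) ip w (F i).
Proof. by rewrite ip_sym ip_suml; apply: eq_bigr => i _; rewrite ip_sym. Qed.

Lemma ip_ge0 u : 0 <= ip u u.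
Proof. exact: le_trans (normr_ge0 _) (sym_op_bound u). Qed.

(** The two signs are the positivity of the squared norms of u + v and u - v. *)
Lemma ip_amgm u v : `|2 * ip u v| <= ip u u + ip v v.
Proof.
rewrite ler_norml; apply/andP; split.
  by have := ip_ge0 (u + v); rewrite !(ipDl, ipDr) (ip_sym v u); lra.
have := ip_ge0 (u + (-1) *: v).
by rewrite !(ipDl, ipDr, ipZl, ipZr) (ip_sym v u); lra.
Qed.

(** The Dirichlet form <u, (I - P) u>. *)
Definition dirichlet u := ip u u - ip u (sym_op u).

(** For a reversible chain, the covariance of f(X_0) and f(X_k). *)
Definition autocorr f k := ip f (iter k (@sym_op R V) f).

Lemma ip_iter f i j :
  ip (iter i (@sym_op R V) f) (iter j (@sym_op R V) f) = autocorr f (i + j).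
Proof. by elim: i j => // i IH j; rewrite iterS sym_op_sym -iterS IH addnS. Qed.

(** An even correlation is the squared norm of an iterate. *)
Lemma autocorr_even_ge0 f k : 0 <= autocorr f k.*2.
Proof. by rewrite -addnn -ip_iter ip_ge0. Qed.

(** With v the k-th iterate of f, the sum is <v, (I + P) v>. *)
Lemma autocorr_pair_ge0 f k : 0 <= autocorr f k.*2 + autocorr f k.*2.+1.
Proof.
rewrite -addnn -addnS -!ip_iter iterS.
have := sym_op_bound (iter k (@sym_op R V) f); rewrite ler_norml => /andP[+ _];
  lra.
Qed.

Lemma dirichlet_ge0 u : 0 <= dirichlet u.
Proof. by rewrite subr_ge0; apply: le_trans (sym_op_bound u);
  exact: ler_norm. Qed.

Lemma ip_sym_opD (a b c : V) : ip a (sym_op (b + c))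
  = ip a (sym_op b) + ip a (sym_op c).
Proof. by rewrite -!(sym_op_sym a) ipDr. Qed.

Lemma ip_sym_opZ x (a b : V) : ip a (sym_op (x *: b)) = x * ip a (sym_op b).
Proof. by rewrite -!(sym_op_sym a) ipZr. Qed.

(** By polarization, from the bound of the operator at u + v and at u - v. *)
Lemma ip_sym_op_amgm u v : 2 * ip u (sym_op v) <= ip u u + ip v v.
Proof.
have := sym_op_bound (u + v); have := sym_op_bound (u + (-1) *: v).
have C : ip v (sym_op u) = ip u (sym_op v) by rewrite -sym_op_sym ip_sym.
rewrite !(ipDl, ipDr, ip_sym_opD, ipZl, ipZr, ip_sym_opZ) (ip_sym v u) C
  !ler_norml.
by move=> /andP[h1 h2] /andP[h3 h4]; lra.
Qed.

(** The operator does not increase the norm, which follows from the bound on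
    the quadratic form alone. *)
Lemma autocorr_even_nincr f k : autocorr f k.+1.*2 <= autocorr f k.*2.
Proof.
have := ip_sym_op_amgm (iter k.+1 (@sym_op R V) f) (iter k (@sym_op R V) f).
by rewrite -iterS !ip_iter !addnn; lra.
Qed.

Lemma autocorr_bound f k : `|autocorr f k| <= autocorr f 0.
Proof.
have even_le j : autocorr f j.*2 <= autocorr f 0.
  by elim: j => // j; apply: le_trans; exact: autocorr_even_nincr.
rewrite -(odd_double_half k); case: (odd k) => /=.
  rewrite add1n (le_trans _ (even_le k./2))// -addnn -addnS -!ip_iter iterS.
  exact: sym_op_bound.
by rewrite add0n ger0_norm ?even_le// autocorr_even_ge0.
Qed.

(** The first n terms of the Neumann series of (I - lam P)^-1 f. Stopping at
    n leaves the remainder lam^n P^n f in the resolvent equation, which is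
    harmless since all the inner products below grow at most quadratically in
    n. *)
Definition resolvent (lam : R) f n : V :=
  \sum_(k < n) lam ^+ k *: iter k (@sym_op R V) f.

Lemma ip_resolvent lam f n v : ip v (resolvent lam f n) =
  \sum_(k < n) lam ^+ k * ip v (iter k (@sym_op R V) f).
Proof.
rewrite /resolvent (ip_sumr _ (fun k => lam ^+ k *: iter k (@sym_op R V) f)).
by apply: eq_bigr => k _; rewrite ipZr.
Qed.

Lemma resolvent_eq lam f n v :
  ip v (resolvent lam f n) - lam * ip v (sym_op (resolvent lam f n)) =
  ip v f - lam ^+ n * ip v (iter n (@sym_op R V) f).
Proof.
rewrite -sym_op_sym !ip_resolvent; elim: n => [|n IH].
  by rewrite !big_ord0 expr0 mulr0 mul1r subr0 subrr.
rewrite !big_ord_recr /= sym_op_sym -iterS exprS; lra.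
Qed.

Section bounds.
Variables (lam : R) (lam0 : 0 <= lam) (lam1 : lam <= 1) (f : V).

Let expl_le1 k : 0 <= lam ^+ k <= 1.
Proof. by rewrite exprn_ge0//= exprn_ile1. Qed.

Lemma ip_resolvent_bound n m :
  `|ip (iter m (@sym_op R V) f) (resolvent lam f n)| <= n%:R * autocorr f 0.
Proof.
rewrite ip_resolvent (le_trans (ler_norm_sum _ _ _))//.
rewrite mulr_natl -[in leRHS](card_ord n) -sumr_const ler_sum// => k _.
rewrite normrM ip_iter; have /andP[h0 h1] := expl_le1 k.
by rewrite ger0_norm// (le_trans _ (autocorr_bound f (m + k)))// ler_piMl.
Qed.

Lemma resolvent_norm_bound n :
  ip (resolvent lam f n) (resolvent lam f n) <= n%:R ^+ 2 * autocorr f 0.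
Proof.
rewrite ip_resolvent expr2 -mulrA.
rewrite [leRHS]mulr_natl -[X in _ *+ X](card_ord n) -sumr_const ler_sum//
  => k _.
have /andP[h0 h1] := expl_le1 k.
rewrite (le_trans (ler_norm _))// normrM ger0_norm// ip_sym.
by rewrite (le_trans _ (ip_resolvent_bound n k))// ler_piMl.
Qed.

(** The quadratic form of I - lam P. *)
Definition resolvent_form u := ip u u - lam * ip u (sym_op u).

Lemma resolvent_formE u : resolvent_form u
  = lam * dirichlet u + (1 - lam) * ip u u.
Proof. by rewrite /resolvent_form /dirichlet; ring. Qed.

Lemma resolvent_form_ge0 u : 0 <= resolvent_form u.
Proof.
by rewrite resolvent_formE addr_ge0// mulr_ge0 ?ip_ge0 ?dirichlet_ge0 ?subr_ge0.
Qed.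

Lemma resolvent_form_resolvent n : resolvent_form (resolvent lam f n) =
  ip f (resolvent lam f n)
  - lam ^+ n * ip (iter n (@sym_op R V) f) (resolvent lam f n).
Proof.
rewrite /resolvent_form resolvent_eq; congr (_ - _ * _); rewrite ip_sym//.
Qed.

(** Positivity of the form at v minus the truncated resolvent: up to the
    remainder of the Neumann series, the latter maximizes 2 <v, f> minus the
    form. *)
Lemma resolvent_variational n v :
  2 * ip v f - resolvent_form v <= ip f (resolvent lam f n) +
    lam ^+ n * (2 * ip v (iter n (@sym_op R V) f)
                - ip (iter n (@sym_op R V) f) (resolvent lam f n)).
Proof.
have := resolvent_form_ge0 (v + (-1) *: resolvent lam f n).
have := resolvent_eq lam f n v; have := resolvent_form_resolvent n.
set h := resolvent lam f n; rewrite /resolvent_form.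
have C : ip h (sym_op v) = ip v (sym_op h) by rewrite -sym_op_sym ip_sym.
rewrite !(ipDl, ipDr, ip_sym_opD, ipZl, ipZr, ip_sym_opZ) (ip_sym h v) C.
lra.
Qed.

End bounds.
End symmetric_contraction.

(** The form of I - lam P is lam times the Dirichlet form plus (1 - lam)
    times the squared norm, so it inherits the factor kappa of both. The
    vector i h / kappa, with h the truncated resolvent of f1, is then a good
    enough candidate in the variational bound for f2. *)
Lemma resolvent_comparison (R : realType) (V1 V2 : symContraction R)
    (i : V1 -> V2) (f1 : V1) (f2 : V2) (kappa lam : R) n :
    1 <= kappa -> 0 <= lam -> lam <= 1 ->
    (forall h, ip (i h) f2 = ip h f1) ->
    (forall h, ip (i h) (i h) <= kappa * ip h h) ->
    (forall h, dirichlet (i h) <= kappa * dirichlet h) ->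
  \sum_(k < n) lam ^+ k * autocorr f1 k <=
  kappa * \sum_(k < n) lam ^+ k * autocorr f2 k +
  (3 * kappa * (autocorr f1 0 + autocorr f2 0)) * (n.+1%:R ^+ 2 * lam ^+ n).
Proof.
move=> k1 l0 l1 if2 inorm idir.
rewrite -!ip_resolvent.
set h := resolvent lam f1 n; set h2 := resolvent lam f2 n.
have k0 : 0 < kappa by lra.
have := resolvent_variational l0 l1 f2 n (kappa^-1 *: i h).
have := resolvent_form_resolvent lam f1 n; rewrite -/h -/h2.
have qi : resolvent_form lam (kappa^-1 *: i h)
  <= kappa^-1 * resolvent_form lam h.
  have -> : resolvent_form lam (kappa^-1 *: i h)
    = kappa^-1 ^+ 2 * resolvent_form lam (i h).
    by rewrite /resolvent_form !(ipZl, ipZr, ip_sym_opZ); ring.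
  rewrite expr2 -mulrA ler_pM2l ?invr_gt0// mulrC ler_pdivrMr//
    mulrC !resolvent_formE.
  have := ler_wpM2l l0 (idir h).
  have l1' : 0 <= 1 - lam by lra.
  by have := ler_wpM2l l1' (inorm h); lra.
have -> : ip (kappa^-1 *: i h) f2 = kappa^-1 * ip f1 h by rewrite ipZl if2
  ip_sym.
set u2 := iter n _ f2; set u1 := iter n _ f1.
rewrite ipZl.
have b1 := ip_resolvent_bound l0 l1 f1 n n; rewrite -/h -/u1 in b1.
have b2 := ip_resolvent_bound l0 l1 f2 n n; rewrite -/h2 -/u2 in b2.
have bh := resolvent_norm_bound l0 l1 f1 n; rewrite -/h in bh.
have b3 := ip_amgm (i h) u2.
have bi := inorm h.
have u20 : ip u2 u2 <= autocorr f2 0.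
  by rewrite ip_iter; apply: le_trans (autocorr_bound f2 (n + n));
    exact: ler_norm.
have c1 : 0 <= autocorr f1 0 by exact: ip_ge0.
have c2 : 0 <= autocorr f2 0 by exact: ip_ge0.
set c10 := autocorr f1 0 in b1 bh c1 *; set c20 := autocorr f2 0 in b2 c2 u20 *.
set L := lam ^+ n; have L0 : 0 <= L by exact: exprn_ge0.
move=> q1 q2.
set a := ip (i h) u2 in b3 q2 *; set b := ip u2 h2 in b2 q2 *.
set e := ip u1 h in b1 q1 *.
have {}q2 : 2 * ip f1 h - resolvent_form lam h
  <= kappa * ip f2 h2 + L * (2 * a - kappa * b).
  have : kappa * (2 * (kappa^-1 * ip f1 h) - kappa^-1 * resolvent_form lam h) <=
      kappa * (ip f2 h2 + L * (2 * (kappa^-1 * a) - b)).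
    by rewrite ler_pM2l//; lra.
  rewrite (_ : kappa * (_ - _) = 2 * ip f1 h - resolvent_form lam h);
    last by field; lra.
  rewrite (_ : kappa * (_ + _) = kappa * ip f2 h2 + L * (2 * a - kappa * b))//.
  by field; lra.
have main : ip f1 h <= kappa * ip f2 h2 + L * (2 * a - kappa * b - e) by lra.
apply: le_trans main _; rewrite lerD2l.
rewrite mulrA [leRHS]mulrC ler_wpM2l//.
move: b1 b2 b3; rewrite !ler_norml => /andP[b1 _] /andP[b2 _] /andP[_ b3].
have kb : - (kappa * b) <= kappa * (n%:R * c20).
  by rewrite -mulrN ler_pM2l//; lra.
have kh : kappa * ip h h <= kappa * (n%:R ^+ 2 * c10) by rewrite ler_pM2l.
rewrite -natr1; set N : R := n%:R in b1 b2 b3 kb kh bh *.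
have N0 : 0 <= N by exact: ler0n.
apply: (@le_trans _ _ (kappa * (N ^+ 2 * c10) + c20 + kappa * (N * c20) + N *
  c10)); first lra.
have k1c1 : 0 <= (kappa - 1) * c10 by apply: mulr_ge0 => //; lra.
have k1c2 : 0 <= (kappa - 1) * c20 by apply: mulr_ge0 => //; lra.
have kc1 : 0 <= kappa * c10 by apply: mulr_ge0 => //; lra.
have kc2 : 0 <= kappa * c20 by apply: mulr_ge0 => //; lra.
have nkc1 := mulr_ge0 N0 k1c1.
have N2kc1 := mulr_ge0 (sqr_ge0 N) kc1.
have N2kc2 := mulr_ge0 (sqr_ge0 N) kc2.
have Nkc1 := mulr_ge0 N0 kc1.
have Nkc2 := mulr_ge0 N0 kc2.
nra.
Qed.

(** * Abel means against Cesaro means of double sums *)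

Section double_sums.
Variable R : realType.
Implicit Types c d : nat -> R.

Definition partial_sum c n := \sum_(k < n) c k.
Definition double_sum c n := \sum_(m < n) partial_sum c m.+1.

(** Summation by parts. *)
Lemma partial_sum_abel c (lam : R) n : \sum_(k < n) lam ^+ k * c k =
  lam ^+ n * partial_sum c n + (1 - lam) * \sum_(m < n) lam ^+ m * partial_sum c
    m.+1.
Proof.
rewrite /partial_sum; elim: n => [|n IH];
  first by rewrite !big_ord0 !mulr0 addr0.
rewrite big_ord_recr/= IH [X in _ = _ + _ * X]big_ord_recr/=.
rewrite [X in _ = _ ^+ _ * X + _]big_ord_recr/=.
rewrite [X in _ = _ + _ * (_ + _ * X)]big_ord_recr/= exprS; ring.
Qed.

(** Summation by parts, twice. *)
Lemma double_sum_abel c (lam : R) n : \sum_(k < n) lam ^+ k * c k =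
  lam ^+ n * partial_sum c n + (1 - lam) * lam ^+ n * double_sum c n +
  (1 - lam) ^+ 2 * \sum_(m < n) lam ^+ m * double_sum c m.+1.
Proof.
rewrite partial_sum_abel -addrA; congr (_ + _); rewrite expr2 -!mulrA -mulrDr.
by congr (_ * _); rewrite (partial_sum_abel (fun m => partial_sum c m.+1)).
Qed.

Lemma sum_geometric (lam : R) n :
  (1 - lam) * \sum_(m < n) lam ^+ m = 1 - lam ^+ n.
Proof.
elim: n => [|n IH]; first by rewrite big_ord0 expr0; ring.
by rewrite big_ord_recr/= mulrDr IH exprS; ring.
Qed.

Lemma sum_arith_geometric (lam : R) n :
  (1 - lam) ^+ 2 * \sum_(m < n) lam ^+ m * m.+1%:R =
  1 - lam ^+ n * (1 + n%:R * (1 - lam)).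
Proof.
elim: n => [|n IH]; first by rewrite big_ord0 expr0; ring.
by rewrite big_ord_recr/= mulrDr IH [lam ^+ n.+1]exprS -natr1; ring.
Qed.

Lemma double_sum_bound c (B : R) n : (forall k, `|c k| <= B) ->
  (`|partial_sum c n| <= n%:R * B) /\ (`|double_sum c n| <= n%:R ^+ 2 * B).
Proof.
move=> cB; have B0 : 0 <= B := le_trans (normr_ge0 _) (cB 0%N).
have pB m : `|partial_sum c m| <= m%:R * B.
  rewrite (le_trans (ler_norm_sum _ _ _))// mulr_natl.
  by rewrite -[X in _ *+ X](card_ord m) -sumr_const ler_sum.
split => //; rewrite (le_trans (ler_norm_sum _ _ _))// expr2 -mulrA mulr_natl.
rewrite -[X in _ *+ X](card_ord n) -sumr_const ler_sum// => k _.
by rewrite (le_trans (pB _))// ler_wpM2r// ler_nat.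
Qed.

(** All the terms nu^m with m <= n of the geometric sum are at least nu^n. *)
Lemma natM_expr_le (nu : R) n : 0 <= nu -> nu < 1 ->
  n.+1%:R * nu ^+ n <= (1 - nu)^-1.
Proof.
move=> n0 n1; rewrite -[leRHS]mul1r ler_pdivlMr ?subr_gt0// mulrC.
apply: le_trans (_ : (1 - nu) * \sum_(m < n.+1) nu ^+ m <= _); last first.
  by rewrite sum_geometric; have := exprn_ge0 n.+1 n0; lra.
rewrite ler_pM2l ?subr_gt0// mulr_natl -[X in _ *+ X](card_ord n.+1)
  -sumr_const.
by rewrite ler_sum// => k _; rewrite ler_wiXn2l// ?ltW// -ltnS.
Qed.

(** Writing the ratio as a cube leaves one spare factor nu^n, which beats the
    bounded quantity ((n + 1) nu^n)^2. *)
Lemma sqr_natM_expr_lt (nu e : R) : 0 <= nu -> nu < 1 -> 0 < e ->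
  exists n, n.+1%:R ^+ 2 * (nu ^+ 3) ^+ n < e.
Proof.
move=> n0 n1 e0; set C := (1 - nu)^-1.
have C0 : 0 < C by rewrite invr_gt0 subr_gt0.
exists (Num.bound (C ^+ 3 / e)); set n := Num.bound _.
have nb : C ^+ 3 / e < n.+1%:R.
  rewrite (lt_trans (_ : _ < n%:R))// ?ltr_nat//.
  by apply: archi_boundP; rewrite divr_ge0 ?exprn_ge0// ltW.
have h := natM_expr_le n n0 n1; rewrite -/C in h.
have h0 : 0 <= n.+1%:R * nu ^+ n by rewrite mulr_ge0 ?exprn_ge0.
have h3 : (n.+1%:R * nu ^+ n) ^+ 3 <= C ^+ 3 by rewrite lerXn2r// nnegrE ltW.
have N0 : (0 : R) < n.+1%:R by rewrite ltr0n.
rewrite -(ltr_pM2l N0); apply: le_lt_trans (_ : C ^+ 3 < _).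
  by rewrite (le_trans _ h3)// [leRHS]exprMn -!exprM (mulnC n) [X in _
    <= X * _]exprS mulrA.
by move: nb; rewrite ltr_pdivrMr.
Qed.

(** If the Abel sums of d are nonnegative up to the truncation error, then
    the double sums of d cannot decrease linearly: by [double_sum_abel] and
    [sum_arith_geometric], a bound K' - eps n on the double sums would force
    the Abel sums below -eps + O(1 - lam). *)
Lemma double_sum_not_linear d (B K K' eps : R) : (forall k, `|d k| <= B) ->
  (forall lam n, 0 <= lam -> lam <= 1 ->
    - (K * (n.+1%:R ^+ 2 * lam ^+ n)) <= \sum_(k < n) lam ^+ k * d k) ->
  0 < eps -> ~ (forall n, double_sum d n <= K' - eps * n%:R).
Proof.
move=> dB low e0 up.
have B0 : 0 <= B := le_trans (normr_ge0 _) (dB 0%N).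
have main lam n : 0 <= lam -> lam <= 1 ->
    eps <= `|K'| * (1 - lam) + (K + 2 * B + eps) * (n.+1%:R ^+ 2 * lam ^+ n).
  move=> l0 l1; have {low} := low lam n l0 l1.
  have [pb db] := double_sum_bound n dB.
  have S : (1 - lam) ^+ 2 * \sum_(m < n) lam ^+ m * double_sum d m.+1 <=
      `|K'| * (1 - lam) - eps * (1 - lam ^+ n * (1 + n%:R * (1 - lam))).
    rewrite -sum_arith_geometric.
    apply: (@le_trans _ _ ((1 - lam) ^+ 2 * (`|K'| * \sum_(m < n) lam ^+ m
        - eps * \sum_(m < n) lam ^+ m * m.+1%:R))).
      rewrite ler_wpM2l ?sqr_ge0// !mulr_sumr -sumrB ler_sum// => m _.
      have := up m.+1; have := ler_norm K'; have := exprn_ge0 m l0.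
      set x := lam ^+ m => x0 k1 k2; nra.
    have := sum_geometric lam n; set G := \sum_(m < n) _ => Ge.
    have : `|K'| * (1 - lam) * ((1 - lam) * G) <= `|K'| * (1 - lam).
      rewrite Ge ler_piMr// ?mulr_ge0// ?subr_ge0//.
      by rewrite lerBlDr lerDl exprn_ge0.
    by set A := \sum_(m < n) _; rewrite expr2; lra.
  rewrite double_sum_abel; set L := lam ^+ n.
  have L0 : 0 <= L by exact: exprn_ge0.
  have N0 : (0 : R) <= n%:R by exact: ler0n.
  rewrite -natr1; set N : R := n%:R in pb db S N0 *.
  have l1' : 0 <= 1 - lam by lra.
  have e1 : L * partial_sum d n <= L * (N * B).
    by rewrite ler_wpM2l// (le_trans (ler_norm _)).
  have e2 : (1 - lam) * L * double_sum d n <= L * (N ^+ 2 * B).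
    apply: (@le_trans _ _ ((1 - lam) * L * (N ^+ 2 * B))).
      by rewrite ler_wpM2l ?mulr_ge0// (le_trans (ler_norm _)).
    by rewrite -mulrA ler_piMl ?mulr_ge0 ?sqr_ge0//; lra.
  have e3 : eps * L * (1 + N * (1 - lam)) <= eps * L * (N + 1) ^+ 2.
    have eL : 0 <= eps * L by rewrite mulr_ge0// ltW.
    rewrite ler_wpM2l//; nra.
  have e4 : L * (N * B) + L * (N ^+ 2 * B) <= 2 * B * (L * (N + 1) ^+ 2).
    have BL : 0 <= B * L by exact: mulr_ge0.
    rewrite (_ : _ + _ = B * L * (N + N ^+ 2)); last by ring.
    rewrite (_ : 2 * _ * _ = B * L * (2 * (N + 1) ^+ 2)); last by ring.
    rewrite ler_wpM2l//; nra.
  move: S; rewrite -/L; lra.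
pose M := 2 * (`|K'| * 3 + eps).
have M0 : 0 < M by rewrite mulr_gt0// ltr_wpDl// mulr_ge0.
(* For lam = nu^3, |K'| (1 - lam) is less than eps / 2: 1 - nu^3 <= 3 (1 - nu). *)
pose nu := 1 - eps / M.
have eM : 0 < eps / M by rewrite divr_gt0.
have eM1 : eps / M <= 1.
  by rewrite ler_pdivrMr// mul1r /M; have := normr_ge0 K'; lra.
have nu0 : 0 <= nu by rewrite /nu; lra.
have nu1 : nu < 1 by rewrite /nu; lra.
set C := K + 2 * B + eps in main.
have C1 : 0 < `|C| + 1 by rewrite ltr_pwDr.
have [n nlt] := sqr_natM_expr_lt nu0 nu1 (divr_gt0 e0 (mulr_gt0 (ltr0n _ 2)
  C1)).
have l0 : 0 <= nu ^+ 3 by exact: exprn_ge0.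
have l1 : nu ^+ 3 <= 1 by rewrite exprn_ile1// ltW.
have := main _ n l0 l1; set x := _ ^+ 2 * _ in nlt *.
have x0 : 0 <= x by rewrite mulr_ge0 ?sqr_ge0 ?exprn_ge0.
have Cx : C * x <= eps / 2.
  apply: (@le_trans _ _ ((`|C| + 1) * x)).
    by rewrite ler_wpM2r//; have := ler_norm C; lra.
  move: nlt; rewrite invfM mulrA ltr_pdivlMr// mulrC => /ltW//.
have : `|K'| * (1 - nu ^+ 3) < eps / 2.
  have h : 1 - nu ^+ 3 <= 3 * (eps / M).
    have -> : eps / M = 1 - nu by rewrite /nu; ring.
    have nu2 : 0 <= nu + 2 by lra.
    rewrite -subr_ge0 (_ : _ - _ = (1 - nu) ^+ 2 * (nu + 2)); last by ring.
    by rewrite mulr_ge0// sqr_ge0.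
  apply: le_lt_trans (ler_wpM2l (normr_ge0 _) h) _.
  have -> : `|K'| * (3 * (eps / M)) = eps * (`|K'| * 3) / M by ring.
  rewrite ltr_pdivrMr// /M; nra.
by move: Cx; lra.
Qed.

(** An Abel-to-Cesaro passage without a Tauberian theorem: both Cesaro limits
    are already known to exist, so a violated inequality between them would
    make the double sums of kappa c2 - c1 decrease linearly. *)
Lemma cesaro_comparison c1 c2 (kappa B K : R) (l1 l2 : \bar R) :
  0 < kappa -> (forall k, `|c1 k| <= B) -> (forall k, `|c2 k| <= B) ->
  (forall lam n, 0 <= lam -> lam <= 1 ->
    \sum_(k < n) lam ^+ k * c1 k <= kappa * \sum_(k < n) lam ^+ k * c2 k +
      K * (n.+1%:R ^+ 2 * lam ^+ n)) ->
  (n%:R^-1 * double_sum c1 n)%:E @[n --> \oo] --> l1 ->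
  (n%:R^-1 * double_sum c2 n)%:E @[n --> \oo] --> l2 ->
  (l1 != -oo -> l2 != -oo -> l1 <= kappa%:E * l2)%E.
Proof.
move=> k0 B1 B2 low cv1 cv2 l1N l2N; rewrite leNgt; apply/negP => lt12.
(* A strict violation leaves no room for l2 to be infinite. *)
have [r2 er2] : exists r, l2 = r%:E.
  case: l2 l2N lt12 {cv2} => [r _ _|_|//]; first by exists r.
  by rewrite gt0_muley ?lte_fin//; case: (l1) => //.
rewrite {l2N}er2 in lt12 cv2 *.
have [x [xl xg]] : exists x : R, kappa * r2 < x /\ (x%:E < l1)%E.
  move: lt12; rewrite -EFinM; case: (l1) l1N => [r _|_ _|//].
    rewrite lte_fin => h; exists ((kappa * r2 + r) / 2).
    by rewrite lte_fin; split; lra.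
  by exists (kappa * r2 + 1); rewrite ltry; split => //; lra.
pose eps := (x - kappa * r2) / 2.
have e0 : 0 < eps by rewrite /eps; lra.
pose B' := (1 + kappa) * B.
have B0 : 0 <= B := le_trans (normr_ge0 _) (B1 0%N).
pose d k := kappa * c2 k - c1 k.
have dB k : `|d k| <= B'.
  rewrite (le_trans (ler_normB _ _))// normrM (gtr0_norm k0) /B'.
  have := B1 k; have := B2 k; rewrite -(ler_pM2l k0); lra.
have sumd lam n : \sum_(k < n) lam ^+ k * d k =
    kappa * (\sum_(k < n) lam ^+ k * c2 k) - \sum_(k < n) lam ^+ k * c1 k.
  by rewrite mulr_sumr -sumrB; apply: eq_bigr => k _; rewrite /d; ring.
have partial_sumd n : partial_sum d n = kappa * partial_sum c2 n - partial_sum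
  c1 n.
  by rewrite /partial_sum mulr_sumr -sumrB.
have double_sumd n : double_sum d n = kappa * double_sum c2 n - double_sum c1 n.
  by rewrite /double_sum mulr_sumr -sumrB; apply: eq_bigr => k _;
    rewrite partial_sumd.
have low' lam n : 0 <= lam -> lam <= 1 ->
    - (K * (n.+1%:R ^+ 2 * lam ^+ n)) <= \sum_(k < n) lam ^+ k * d k.
  by move=> h0 h1; rewrite sumd; have := low lam n h0 h1; lra.
have [n0 n0P] : exists n0 : nat, forall n, (n0 <= n)%N ->
    double_sum d n <= - (eps * n%:R).
  have ev1 : \forall n \near \oo, (x%:E < (n%:R^-1 * double_sum c1 n)%:E)%E.
    by move: cv1 => /(_ [set y | (x%:E < y)%E]); apply; exact: open_ereal_gt'.
  have ev2 : \forall n \near \oo,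
      ((n%:R^-1 * double_sum c2 n)%:E < (r2 + eps / kappa)%:E)%E.
    move: cv2 => /(_ [set y | (y < (r2 + eps / kappa)%:E)%E]); apply.
    by apply: open_ereal_lt'; rewrite lte_fin ltrDl divr_gt0.
  have [n0 _ n0P] := filterI ev1 ev2.
  exists n0.+1 => n n0n; have [/=] := n0P n (ltnW n0n).
  have npos : (0 : R) < n%:R by rewrite ltr0n (leq_trans _ n0n).
  rewrite !lte_fin mulrC ltr_pdivlMr// mulrC ltr_pdivrMl// => h1.
  rewrite -(ltr_pM2l k0) double_sumd => h2.
  have : kappa * (n%:R * (r2 + eps / kappa)) = n%:R * (kappa * r2 + eps).
    by field; lra.
  move: h2 => /[swap] ->; rewrite /eps; lra.
apply: (@double_sum_not_linear d B' K (n0%:R ^+ 2 * B' + eps * n0%:R) eps dB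
  low' e0) => n.
have [nn0|nn0] := leqP n0 n.
  have := n0P n nn0; have : 0 <= n0%:R ^+ 2 * B' + eps * n0%:R.
    by rewrite addr_ge0 ?mulr_ge0 ?sqr_ge0 ?(ltW e0)// /B'; lra.
  lra.
have [_ db] := double_sum_bound n dB.
have h : n%:R ^+ 2 * B' <= n0%:R ^+ 2 * B'.
  rewrite ler_wpM2r//; first by rewrite /B' mulr_ge0//; lra.
  by rewrite lerXn2r ?nnegrE ?ler0n// ler_nat ltnW.
have h' : eps * n%:R <= eps * n0%:R by rewrite ler_pM2l// ler_nat ltnW.
have := ler_norm (double_sum d n); lra.
Qed.

End double_sums.

(** * Existence of the asymptotic variance *)

Lemma cvg_parity (R : realType) (u : R^nat) (l : R) :
  u n.*2 @[n --> \oo] --> l -> u n.*2.+1 @[n --> \oo] --> l -> u @ \oo --> l.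
Proof.
move=> /cvgrPdist_lt u0 /cvgrPdist_lt u1; apply/cvgrPdist_lt => e e0.
have [n0 _ n0P] := u0 e e0; have [n1 _ n1P] := u1 e e0.
exists (maxn n0 n1).*2.+1 => // n /= nn.
have half : (maxn n0 n1 <= n./2)%N.
  by rewrite -(doubleK (maxn n0 n1)) half_leq// ltnW.
rewrite -(odd_double_half n); case: (odd n) => /=.
  by rewrite add1n; apply: n1P; rewrite /= (leq_trans _ half)// leq_maxr.
by rewrite add0n; apply: n0P; rewrite /= (leq_trans _ half)// leq_maxl.
Qed.

Section existence.
Variables (R : realType) (c : nat -> R).
Hypothesis even_ge0 : forall k, 0 <= c k.*2.
Hypothesis even_nincr : forall k, c k.+1.*2 <= c k.*2.
Hypothesis pair_ge0 : forall k, 0 <= c k.*2 + c k.*2.+1.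

Let a k := c k.*2 + c k.*2.+1.

Let partial_sum_double n : partial_sum c n.*2 = series a n.
Proof.
elim: n => [|n IH]; first by rewrite /partial_sum seriesEord/= !big_ord0.
by rewrite doubleS /partial_sum !big_ord_recr/= -/(partial_sum c n.*2) IH -addrA
  seriesSr.
Qed.

Let series_nd : nondecreasing_seq (series a).
Proof. by apply/nondecreasing_seqP => n; rewrite seriesSr lerDl pair_ge0. Qed.

Let partial_sum_ge n : series a n./2 <= partial_sum c n.
Proof.
rewrite -[n in leRHS]odd_double_half; case: (odd n) => /=.
  by rewrite add1n /partial_sum big_ord_recr/= -/(partial_sum c _)
    partial_sum_double lerDl.
by rewrite add0n partial_sum_double.
Qed.

Let series_ge0 n : 0 <= series a n.
Proof. by rewrite seriesEord sumr_ge0// => i _; exact: pair_ge0. Qed.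

Let even_le0 k : c k.*2 <= c 0%N.
Proof. by elim: k => // k; apply: le_trans. Qed.

Let partial_sum_le n : partial_sum c n <= series a n./2 + c 0%N.
Proof.
rewrite -[n in leLHS]odd_double_half; case: (odd n) => /=.
  by rewrite add1n /partial_sum big_ord_recr/= -/(partial_sum c _)
    partial_sum_double lerD2l.
by rewrite add0n partial_sum_double lerDl (even_ge0 0).
Qed.

Let avg_sum n : \sum_(m < n) (partial_sum c m.+1 + partial_sum c m.+2) / 2 =
  double_sum c n + (partial_sum c n.+1 - c 0%N) / 2.
Proof.
elim: n => [|n IH].
  by rewrite /double_sum /partial_sum !big_ord_recr !big_ord0/=; lra.
rewrite big_ord_recr/= IH /double_sum [in RHS]big_ord_recr/=; lra.
Qed.

(** The series of the pair sums c_2k + c_(2k+1) has nonnegative terms. If it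
    diverges, the partial sums of c tend to infinity and so do their means.
    If it converges to S, then c_2k has a limit L, which may be nonzero when
    -1 is an eigenvalue of the operator; the partial sums of c may then
    oscillate, but the means of two consecutive ones tend to S + L / 2. *)
Lemma double_sum_cvg :
  exists2 l : \bar R, l != -oo%E & (n%:R^-1 * double_sum c n)%:E @[n --> \oo]
    --> l.
Proof.
have [cva|/(nondecreasing_dvgn_lt series_nd) dva] := pselect (cvgn (series a));
  last first.
  exists +oo%E => //; apply/cvgeyPge => A.
  have [n0 _ /(_ _ (leqnn n0)) /= n0P] := (cvgryPge _).1 dva (`|A| * 2).
  exists (n0.*2.*2.+1) => // n /= nn; rewrite lee_fin.
  have npos : (0 : R) < n%:R by rewrite ltr0n (leq_trans _ nn).
  rewrite mulrC ler_pdivlMr// (le_trans (ler_wpM2r (ltW npos) (ler_norm A)))//.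
  have nn' : (n0.*2 <= n)%N.
    by apply: leq_trans (ltnW nn); rewrite -[leqRHS]addnn leq_addr.
  have -> : double_sum c n = \sum_(0 <= m < n) partial_sum c m.+1 by rewrite
    big_mkord.
  rewrite (big_cat_nat (leq0n _) nn')/=.
  have h1 : 0 <= \sum_(0 <= i < n0.*2) partial_sum c i.+1.
    by rewrite sumr_ge0// => i _; apply: le_trans (partial_sum_ge _).
  have h2 : (n - n0.*2)%:R * (`|A| * 2) <= \sum_(n0.*2
    <= i < n) partial_sum c i.+1.
    rewrite mulr_natl -sumr_const_nat !big_nat ler_sum// => i /andP[ni _].
    rewrite (le_trans n0P)// (le_trans _ (partial_sum_ge _))// series_nd//.
    by rewrite -[leqLHS]doubleK half_leq// ltnW.
  have h3 : n%:R <= (n - n0.*2)%:R * (2 : R).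
    rewrite -natrM ler_nat muln2 -addnn -(leq_add2r n0.*2) -addnA subnK//.
    by rewrite addnC leq_add2r leq_subRL// addnn ltnW.
  have := ler_wpM2r (normr_ge0 A) h3; lra.
have cvc : cvgn (fun k => c k.*2).
  apply: nonincreasing_is_cvgn; last by exists 0 => _ [n _ <-].
  exact/nonincreasing_seqP.
have a0 := cvg_series_cvg_0 cva.
set S := limn (series a) in cva *; set L := limn (fun k => c k.*2) in cvc *.
(* Consecutive partial sums are averaged so that the oscillation cancels. *)
have cvx : (fun m => (partial_sum c m.+1 + partial_sum c m.+2) / 2) @ \oo --> S
  + L / 2.
  apply: cvg_parity.
    have -> : (fun n => (partial_sum c n.*2.+1 + partial_sum c n.*2.+2) / 2) =
        (fun n => series a n + c n.*2 / 2 + a n / 2).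
      apply/funext => n; rewrite -doubleS partial_sum_double seriesSr.
      rewrite /partial_sum big_ord_recr/= -/(partial_sum c _)
        partial_sum_double; lra.
    rewrite -[X in _ --> X]addr0 -[X in _ --> _ + X](mul0r 2^-1).
    apply: cvgD; last exact: cvgMr_tmp a0.
    by apply: cvgD => //; exact: cvgMr_tmp cvc.
  have -> : (fun n => (partial_sum c n.*2.+2 + partial_sum c n.*2.+3) / 2) =
      (fun n => series a n.+1 + c n.+1.*2 / 2).
    apply/funext => n; rewrite -doubleS partial_sum_double.
    rewrite /partial_sum big_ord_recr/= -/(partial_sum c _) partial_sum_double;
      lra.
  apply: cvgD; first by rewrite (cvg_shiftS (series a)).
  by apply: cvgMr_tmp; rewrite (cvg_shiftS (fun k => c k.*2)).
suff main : n%:R^-1 * double_sum c n @[n --> \oo] --> S + L / 2.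
  by exists (S + L / 2)%:E => //; apply: cvg_EFin; [exact: nearW|exact: main].
suff : n.+1%:R^-1 * double_sum c n.+1 @[n --> \oo] --> S + L / 2.
  by rewrite -(cvg_shiftS (fun n => n%:R^-1 * double_sum c n)).
have -> : (fun n => n.+1%:R^-1 * double_sum c n.+1) = (fun n =>
    arithmetic_mean (fun m => (partial_sum c m.+1 + partial_sum c m.+2) / 2) n +
    (c 0%N / 2 * harmonic n - 2^-1 * (harmonic n * partial_sum c n.+2))).
  apply/funext => n; rewrite /arithmetic_mean/= seriesEord/= avg_sum; ring.
have harm x : x * harmonic n @[n --> \oo] --> (0 : R).
  rewrite -[X in _ --> X](mulr0 x). apply: cvgMl_tmp; exact: cvg_harmonic.
suff tail : harmonic n * partial_sum c n.+2 @[n --> \oo] --> (0 : R).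
  rewrite -[X in _ --> X]addr0 -[X in _ --> _ + X](subrr 0).
  apply: cvgD; first exact: cesaro.
  apply: cvgB; first exact: harm.
  by rewrite -[X in _ --> X](mulr0 2^-1); apply: cvgMl_tmp.
apply: (@squeeze_cvgr _ _ _ _ (cst 0) (fun n => (S + c 0%N) * harmonic n)) =>
  //.
  apply: nearW => n /=; rewrite mulr_ge0 ?invr_ge0//=; last first.
    exact: le_trans (partial_sum_ge _).
  rewrite mulrC ler_wpM2r ?invr_ge0// (le_trans (partial_sum_le _))// lerD2r.
  exact: nondecreasing_cvgn_le.
exact: cvg_cst.
Qed.

End existence.

(** * The asymptotic variance of a symmetric contraction *)

(** For a stationary reversible chain and centred f, the variance of f(X_1) +
    ... + f(X_n): each lag k from 1 to n - 1 occurs 2 (n - k) times. *)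
Definition path_sum_variance (R : realType) (V : symContraction R) (f : V) n
  : R :=
  2 * double_sum (autocorr f) n - n%:R * autocorr f 0.

Definition asymptotic_var (R : realType) (V : symContraction R) (f : V)
  : \bar R :=
  limn (fun n => (n%:R^-1 * path_sum_variance f n)%:E).

Lemma asymptotic_var_limit (R : realType) (V : symContraction R) (f : V) :
  exists l : \bar R, [/\ l != -oo%E,
    (n%:R^-1 * double_sum (autocorr f) n)%:E @[n --> \oo] --> l &
    asymptotic_var f = (2%:E * l - (autocorr f 0)%:E)%E].
Proof.
have [l lN cl] := double_sum_cvg (autocorr_even_ge0 f) (autocorr_even_nincr f)
  (autocorr_pair_ge0 f).
exists l; split => //; apply: cvg_lim => //.
have : (2%:E * (n%:R^-1 * double_sum (autocorr f) n)%:E + (- autocorr f 0)%:E)%E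
    @[n --> \oo] --> (2%:E * l - (autocorr f 0)%:E)%E.
  apply: cvgeD; last exact: cvg_cst.
    by rewrite fin_num_adde_defl// fin_numN.
  exact: cvgeZl.
apply: cvg_trans; apply: near_eq_cvg; exists 1%N => // n /= n0.
rewrite -EFinM -EFinD; congr EFin; rewrite /path_sum_variance.
have : n%:R != 0 :> R by rewrite pnatr_eq0 -lt0n.
by move=> ?; field.
Qed.

(** The asymptotic variance is twice the limit of the Cesaro means minus the
    squared norm of f, and [cesaro_comparison] bounds the limits. *)
Theorem asymptotic_var_comparison (R : realType) (V1 V2 : symContraction R)
    (i : V1 -> V2) (f1 : V1) (f2 : V2) (kappa : R) :
    1 <= kappa ->
    (forall h, ip (i h) f2 = ip h f1) ->
    (forall h, ip (i h) (i h) <= kappa * ip h h) ->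
    (forall h, dirichlet (i h) <= kappa * dirichlet h) ->
    ip f1 f1 = ip f2 f2 ->
  (asymptotic_var f1 <= kappa%:E * asymptotic_var f2 + (kappa - 1)%:E * (ip f2
    f2)%:E)%E.
Proof.
move=> k1 if2 inorm idir f12.
have [l1 [l1N cl1 ->]] := asymptotic_var_limit f1;
  have [l2 [l2N cl2 ->]] := asymptotic_var_limit f2.
have k0 : 0 < kappa by lra.
pose B := autocorr f2 0.
have c12 : autocorr f1 0 = B by rewrite /autocorr/= f12.
have le12 : (l1 <= kappa%:E * l2)%E.
  apply: (cesaro_comparison (B := B) k0 _ _ _ cl1 cl2 l1N l2N).
  - by move=> k; rewrite -c12 autocorr_bound.
  - by move=> k; rewrite autocorr_bound.
  - move=> lam n l0 l1'; exact: (resolvent_comparison n k1 l0 l1' if2 inorm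
    idir).
rewrite c12 -/(autocorr f2 0) -/B -EFinM.
case: l2 l2N le12 {cl2} => [r2 _|_ _|//]; last first.
  by rewrite gt0_muley ?lte_fin//= gt0_muley ?lte_fin//= leey.
case: l1 l1N {cl1} => [r1 _|//|//].
by rewrite -!EFinM -?EFinB -?EFinM -?EFinD !lee_fin; lra.
Qed.

Corollary asymptotic_var_monotone (R : realType) (V1 V2 : symContraction R)
    (i : V1 -> V2) (f1 : V1) (f2 : V2) :
    (forall h, ip (i h) f2 = ip h f1) ->
    (forall h, ip (i h) (i h) = ip h h) ->
    (forall h, dirichlet (i h) <= dirichlet h) ->
    ip f1 f1 = ip f2 f2 ->
  (asymptotic_var f1 <= asymptotic_var f2)%E.
Proof.
move=> if2 inorm idir f12.
have := asymptotic_var_comparison (i := i) (kappa := 1) (lexx _) if2 _ _ f12.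
rewrite mul1e subrr mul0e adde0; apply => h; rewrite mul1r// inorm//.
Qed.

Local Open Scope ereal_scope.

(** * Integration against kernels *)

Section mixture.
Context d d' (X : measurableType d) (Z : measurableType d') (R : realType).
Variables (mu : {measure set X -> \bar R}) (nu : {measure set Z -> \bar R}).
Variable k : X -> {measure set Z -> \bar R}.
Hypothesis mk : forall A, measurable A -> measurable_fun [set: X] (k ^~ A).
Hypothesis nuE : forall A, measurable A -> nu A = \int[mu]_x k x A.

Import HBNNSimple.

Let mixture_nnsfun (f : {nnsfun Z >-> R}) :
  \int[nu]_z (f z)%:E = \int[mu]_x \int[k x]_z (f z)%:E.
Proof.
have fE (m : {measure set Z -> \bar R}) : \int[m]_z (f z)%:E =
    \sum_(r \in range f) r%:E * m (f @^-1` [set r]).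
  by rewrite integralT_nnsfun sintegralE.
rewrite fE (eq_integral (fun x => \sum_(r \in range f) r%:E * k x (f @^-1` [set
  r]))); last first.
  by move=> x _; rewrite fE.
rewrite ge0_integral_fsum//; last 2 first.
- by move=> r; apply: measurable_funeM; exact: mk.
- move=> r x _; have := mulemu_ge0 (fun r => f @^-1` [set r]).
  by apply; exact: preimage_nnfun0.
apply: eq_fsbigr => r /set_mem [z _ <-].
rewrite ge0_integralZl//; first by rewrite nuE.
- exact: mk.
- by rewrite lee_fin.
Qed.

(** The integral against a mixture of measures; this covers the integrals
    against joint laws and against measures with a density. *)
Lemma ge0_integral_mixture (f : Z -> \bar R) :
  measurable_fun [set: Z] f -> (forall z, 0 <= f z) ->
  \int[nu]_z f z = \int[mu]_x \int[k x]_z f z.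
Proof.
move=> mf f0; pose f_ := nnsfun_approx measurableT mf.
have lim_f (m : {measure set Z -> \bar R}) :
    \int[m]_z f z = limn (fun n => \int[m]_z (f_ n z)%:E).
  rewrite -monotone_convergence//; last 3 first.
  - by move=> n; exact/measurable_EFinP.
  - by move=> n z _; rewrite lee_fin.
  - by move=> z _ a b ab; rewrite lee_fin; exact/lefP/nd_nnsfun_approx.
  apply: eq_integral => z _; apply/esym/cvg_lim => //.
  exact: cvg_nnsfun_approx.
rewrite lim_f; under eq_fun do rewrite mixture_nnsfun.
rewrite -monotone_convergence//; last 3 first.
- move=> n; apply: measurable_fun_integral_kernel => //.
  + by move=> z; rewrite lee_fin.
  + exact/measurable_EFinP.
- by move=> n x _; apply: integral_ge0 => z _; rewrite lee_fin.
- move=> x _ a b ab; apply: ge0_le_integral => //.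
  + by move=> z _; rewrite lee_fin.
  + exact/measurable_EFinP.
  + exact/measurable_EFinP.
  + by move=> z _; rewrite lee_fin; exact/lefP/nd_nnsfun_approx.
by apply: eq_integral => x _; rewrite lim_f.
Qed.

End mixture.

Section image_measure.
Context d d' (X : measurableType d) (Y : measurableType d') (R : realType).
Variables (mu : {measure set X -> \bar R}) (f : X -> Y).

(** The push-forward bundled with its measure structure, for a map whose
    measurability is only known through a proof. *)
Definition image_measure (mf : measurable_fun [set: X] f) :
  {measure set Y -> \bar R}.
Proof. by unshelve refine (pushforward mu f : {measure set Y
  -> \bar R}). Defined.

Lemma ge0_integral_image_measure (mf : measurable_fun [set: X] f)
    (phi : Y -> \bar R) : measurable_fun [set: Y] phi
      -> (forall y, 0 <= phi y) ->
  \int[image_measure mf]_y phi y = \int[mu]_x phi (f x).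
Proof. by move=> mphi phi0; rewrite ge0_integral_pushforward. Qed.

End image_measure.

Section semidirect_integral.
Context d d' (X : measurableType d) (Y : measurableType d') (R : realType).
Variables (mu : {measure set X -> \bar R}) (k : R.-pker X ~> Y).

Lemma ge0_integral_semidirect (phi : X * Y -> \bar R) :
  measurable_fun [set: X * Y] phi -> (forall z, 0 <= phi z) ->
  \int[semidirect mu k]_z phi z = \int[mu]_x \int[k x]_y phi (x, y).
Proof.
move=> mphi phi0; pose kappa x := image_measure (k x) (measurable_pair1 x).
have kappaE x A : kappa x A = k x (xsection A x) by rewrite xsectionE.
rewrite (@ge0_integral_mixture _ _ _ _ _ mu (semidirect mu k) kappa)//.
- by apply: eq_integral => x _; rewrite ge0_integral_image_measure.
- move=> A mA; under eq_fun do rewrite kappaE.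
  by apply: measurable_fun_xsection_finite_kernel; rewrite inE.
- by move=> A mA; apply: eq_integral => x _; rewrite kappaE.
Qed.

Lemma measurable_fun_ge0_semidirect (phi : X * Y -> \bar R) :
  measurable_fun [set: X * Y] phi -> (forall z, 0 <= phi z) ->
  measurable_fun [set: X] (fun x => \int[k x]_y phi (x, y)).
Proof. by move=> mphi phi0; exact: measurable_fun_integral_sfinite_kernel. Qed.

Lemma ge0_integral_semidirect_fst (phi : X -> \bar R) :
  measurable_fun [set: X] phi -> (forall x, 0 <= phi x) ->
  \int[semidirect mu k]_z phi z.1 = \int[mu]_x phi x.
Proof.
move=> mphi phi0; rewrite ge0_integral_semidirect//;
  last exact: measurableT_comp.
by apply: eq_integral => x _ /=; rewrite integral_cst//= prob_kernel mule1.
Qed.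

(** Since the integral of a signed function is by definition the difference
    of those of its positive and negative parts, Tonelli's theorem for the
    two parts suffices. *)
Lemma integral_semidirect (phi : X * Y -> \bar R) :
  (semidirect mu k).-integrable [set: X * Y] phi ->
  \int[semidirect mu k]_z phi z = \int[mu]_x \int[k x]_y phi (x, y).
Proof.
move=> iphi; have mphi := measurable_int _ iphi.
have tonelli (psi : X * Y -> \bar R) : (semidirect mu k).-integrable setT psi ->
    (forall z, 0 <= psi z) ->
    \int[semidirect mu k]_z psi z = \int[mu]_x \int[k x]_y psi (x, y) /\
    mu.-integrable setT (fun x => \int[k x]_y psi (x, y)).
  move=> ipsi psi0; have mpsi := measurable_int _ ipsi.
  split; first exact: ge0_integral_semidirect.
  apply/integrableP; split; first exact: measurable_fun_ge0_semidirect.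
  under eq_integral do rewrite gee0_abs ?integral_ge0//.
  rewrite -ge0_integral_semidirect//; have /integrableP[_] := ipsi.
  by under eq_integral do rewrite gee0_abs//.
have [ep ip] := tonelli _ (integrable_funepos measurableT iphi) (fun=>
  funepos_ge0 _ _).
have [en in_] := tonelli _ (integrable_funeneg measurableT iphi) (fun=>
  funeneg_ge0 _ _).
rewrite [LHS]integralE ep en -integralB//; apply: eq_integral => x _.
by rewrite [RHS]integralE; congr (_ - _); apply: eq_integral => y _;
  rewrite ?funeposE ?funenegE.
Qed.

End semidirect_integral.

Section density.
Context d (X : measurableType d) (R : realType).
Variables (mu nu : {measure set X -> \bar R}) (f : X -> R).
Hypotheses (mf : measurable_fun [set: X] f) (f0 : forall x, (0 <= f x)%R).

Lemma ge0_integral_density (phi : X -> \bar R) :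
  (forall A, measurable A -> nu A = \int[mu]_(x in A) (f x)%:E) ->
  measurable_fun [set: X] phi -> (forall x, 0 <= phi x) ->
  \int[nu]_x phi x = \int[mu]_x ((f x)%:E * phi x).
Proof.
move=> nuE mphi phi0.
pose k x : {measure set X -> \bar R} := mscale (NngNum (f0 x)) \d_x.
have kE x A : k x A = (f x * \1_A x)%:E by rewrite /k /= /mscale/= diracE EFinM
  indicE.
rewrite (@ge0_integral_mixture _ _ _ _ _ mu nu k)//.
- apply: eq_integral => x _; rewrite ge0_integral_mscale//= integral_dirac//.
  by rewrite diracT mul1e.
- move=> A mA; under eq_fun do rewrite kE.
  by apply/measurable_EFinP; apply: measurable_funM => //;
    exact: measurable_indic.
- move=> A mA; rewrite nuE// integral_mkcond; apply: eq_integral => x _.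
  by rewrite kE patchE indicE; case: ifPn; rewrite ?mulr1 ?mulr0.
Qed.

End density.

Section mh_integral.
Context d (T : measurableType d) (R : realType).
Variables (k : R.-pker T ~> T) (a : acceptance T R).

Lemma measurable_accept2 x : measurable_fun [set: T] (fun y => (a (x, y))%:E).
Proof.
by apply/measurable_EFinP; apply: measurable_fun_pair2;
  exact: measurable_accept.
Qed.

Lemma acceptance_rate_le1 x : 0 <= \int[k x]_y (a (x, y))%:E <= 1.
Proof.
apply/andP; split; first by apply: integral_ge0 => y _;
  rewrite lee_fin accept_ge0.
rewrite -(prob_kernel (s := k) x) -[leRHS]mul1e -(integral_cst (k x)
  measurableT).
apply: ge0_le_integral => //.
- by move=> y _; rewrite lee_fin accept_ge0.
- exact: measurable_accept2.
- by move=> y _; rewrite lee_fin accept_le1.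
Qed.

Lemma rejection_ge0 x : 0 <= rejection k a x.
Proof.
have /andP[h0 h1] := acceptance_rate_le1 x.
by rewrite sube_ge0 ?h1// ge0_fin_numE// (le_lt_trans h1)// ltry.
Qed.

Lemma rejection_fin_num x : rejection k a x \is a fin_num.
Proof.
have /andP[h0 h1] := acceptance_rate_le1 x.
by rewrite fin_numB/= ge0_fin_numE// (le_lt_trans h1)// ltry.
Qed.

Lemma ge0_integral_mh_kernel x (phi : T -> \bar R) :
  measurable_fun [set: T] phi -> (forall y, 0 <= phi y) ->
  \int[mh_kernel k a x]_y phi y =
  \int[k x]_y ((a (x, y))%:E * phi y) + rejection k a x * phi x.
Proof.
move=> mphi phi0.
pose kd := mkdensity k (measurable_accept a) (accept_ge0 a) x.
have r0 := rejection_ge0 x.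
have fr0 : (0 <= fine (rejection k a x))%R by exact: fine_ge0.
pose kr : {measure set T -> \bar R} := mscale (NngNum fr0) \d_x.
rewrite (eq_measure_integral (measure_add kd kr)); last first.
  move=> A mA _; transitivity (kd A + kr A); last exact/esym/measure_addE.
  by rewrite /kd /kr /= /mscale/= fineK// rejection_fin_num.
rewrite ge0_integral_measure_add//; congr (_ + _).
  rewrite (ge0_integral_density (mu := k x) (f := fun y => a (x, y)))//.
  - by apply/measurable_EFinP; exact: measurable_accept2.
  - by move=> y; exact: accept_ge0.
rewrite ge0_integral_mscale//= integral_dirac// diracT mul1e fineK//.
exact: rejection_fin_num.
Qed.

End mh_integral.

(** * Square-integrable functions and conditional means *)

Section square_integrable.
Context d (T : measurableType d) (R : realType).

Lemma Lfun2P (mu : {measure set T -> \bar R}) (f : T -> R) :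
  f \in Lfun mu 2%:E <->
  measurable_fun [set: T] f /\ \int[mu]_x ((f x) ^+ 2)%:E < +oo.
Proof.
split=> [l2f|[mf f2]].
  split; first by move: l2f; rewrite inE => /andP[]; rewrite inE.
  have /integrableP[_] := Lfun2_integrable_sqr l2f.
  by under eq_integral do rewrite /= normrX real_normK ?num_real//.
rewrite inE; apply/andP; split; rewrite inE//=.
rewrite /finite_norm unlock /Lnorm poweR_lty//.
under eq_integral => x _ do rewrite /= powR_mulrn// real_normK ?num_real//.
exact: f2.
Qed.

Lemma Lfun2_mul_integrable (mu : {measure set T -> \bar R}) (f g : T -> R) :
  f \in Lfun mu 2%:E -> g \in Lfun mu 2%:E ->
  mu.-integrable [set: T] (fun x => (f x * g x)%:E).
Proof. by move=> lf lg; exact/Lfun1_integrable/Lfun2_mul_Lfun1. Qed.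

Section unit_mass.
Variables (P : {measure set T -> \bar R}) (P1 : P [set: T] = 1).

Lemma unit_mass_integral_cst (c : R) : \int[P]_x c%:E = c%:E.
Proof. by rewrite (integral_cst P measurableT)/= P1 mule1. Qed.

Lemma unit_mass_integrable_cst (c : R) : P.-integrable [set: T] (fun=> c%:E).
Proof.
apply/integrableP; split; first exact: measurable_cst.
by rewrite /= unit_mass_integral_cst ltry.
Qed.

Lemma Lfun2_integrable (f : T -> R) :
  f \in Lfun P 2%:E -> P.-integrable [set: T] (fun x => (f x)%:E).
Proof.
move=> lf; have [mf _] := (Lfun2P _ _).1 lf.
apply: (@le_integrable _ _ _ P _ measurableT _ (fun x => (1 + f x ^+ 2)%:E)).
- exact/measurable_EFinP.
- move=> x _ /=; rewrite lee_fin (ger0_norm (addr_ge0 ler01 (sqr_ge0 _))).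
  rewrite -[(f x ^+ 2)%R]real_normK ?num_real//.
  by have := sqr_ge0 (`|f x| - 1)%R; have := normr_ge0 (f x); nra.
- under eq_fun do rewrite EFinD.
  apply: integrableD => //; first exact: unit_mass_integrable_cst.
  exact: Lfun2_integrable_sqr.
Qed.

(** No integrability of f is assumed: if the right-hand side is finite then f
    is square integrable, and otherwise there is nothing to prove. In the
    former case, integrate (f - c)^2 >= 2 (m - c) (f - c) - (m - c)^2, where
    m is the mean of f. *)
Lemma jensen_sqr (f : T -> R) (c : R) : measurable_fun [set: T] f ->
  ((fine (\int[P]_x (f x)%:E) - c) ^+ 2)%:E <= \int[P]_x ((f x - c) ^+ 2)%:E.
Proof.
move=> mf; have [fc|] := ltP (\int[P]_x ((f x - c) ^+ 2)%:E) +oo; last first.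
  by rewrite leye_eq => /eqP->; rewrite leey.
have mfc : measurable_fun [set: T] (fun x => f x - c)%R by exact:
  measurable_funB.
have lfc : (fun x => f x - c)%R \in Lfun P 2%:E by exact/Lfun2P.
have intf : P.-integrable [set: T] (fun x => (f x)%:E).
  rewrite (_ : (fun x => (f x)%:E) = (fun x => (f x - c)%:E + c%:E));
    last first.
    by apply/funext => x /=; rewrite -EFinD subrK.
  apply: integrableD => //; last exact: unit_mass_integrable_cst.
  exact: Lfun2_integrable.
have fin_f := integrable_fin_num measurableT intf.
set m := fine _.
rewrite (_ : ((m - c) ^+ 2)%:E =
    \int[P]_x ((2 * (m - c) * f x)%R - (m ^+ 2 - c ^+ 2)%R)%:E); last first.
  under [RHS]eq_integral do rewrite EFinB.
  have iZ : P.-integrable setT (fun x => (2 * (m - c) * f x)%:E).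
    by under eq_fun do rewrite EFinM; exact: integrableZl.
  rewrite integralB_EFin//; last exact: unit_mass_integrable_cst.
  rewrite unit_mass_integral_cst.
  under [X in _ = X - _]eq_integral do rewrite EFinM.
  rewrite integralZl//= -(fineK fin_f) -/m -EFinM -EFinB; congr EFin; ring.
apply: le_integral => //.
- under eq_fun do rewrite EFinB.
  apply: integrableB => //; last exact: unit_mass_integrable_cst.
  by under eq_fun do rewrite EFinM; exact: integrableZl.
- exact: Lfun2_integrable_sqr lfc.
- move=> x _; rewrite lee_fin; have := sqr_ge0 (f x - m); lra.
Qed.

End unit_mass.
End square_integrable.

Section kernel_mean.
Context d d' (X : measurableType d) (Y : measurableType d') (R : realType).
Variables (mu : {measure set X -> \bar R}) (k : R.-pker X ~> Y).

(** The conditional mean of phi given the first coordinate. Where the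
    integral is infinite or undefined the value is a default one, and
    [jensen_sqr] holds all the same; this is why no null set appears in
    [kernel_mean_L2]. *)
Definition kernel_mean (phi : X * Y -> R) (x : X) : R :=
  fine (\int[k x]_y (phi (x, y))%:E).

Lemma measurable_fun_kernel_integral (phi : X * Y -> \bar R) :
  measurable_fun [set: X * Y] phi ->
  measurable_fun [set: X] (fun x => \int[k x]_y phi (x, y)).
Proof.
move=> mphi.
rewrite (_ : (fun _ => _) = (fun x =>
    \int[k x]_y phi^\+ (x, y) - \int[k x]_y phi^\- (x, y))); last first.
  apply/funext => x; rewrite integralE.
  by congr (_ - _); apply: eq_integral => y _; rewrite ?funeposE ?funenegE.
by apply: emeasurable_funB; apply: measurable_fun_ge0_semidirect => //;
  [exact: measurable_funepos|exact: measurable_funeneg].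
Qed.

Lemma measurable_kernel_mean (phi : X * Y -> R) :
  measurable_fun [set: X * Y] phi -> measurable_fun [set: X] (kernel_mean phi).
Proof.
move=> mphi; apply: measurableT_comp => //.
apply: (@measurable_fun_kernel_integral (EFin \o phi)).
exact/measurable_EFinP.
Qed.

Lemma kernel_mean_L2 (phi : X * Y -> R) :
  phi \in Lfun (semidirect mu k) 2%:E -> kernel_mean phi \in Lfun mu 2%:E.
Proof.
move=> /Lfun2P[mphi phi2]; apply/Lfun2P; split;
  first exact: measurable_kernel_mean.
apply: le_lt_trans phi2; rewrite ge0_integral_semidirect; last 2 first.
- by apply/measurable_EFinP; exact: measurable_funX.
- by move=> z; rewrite lee_fin sqr_ge0.
apply: ge0_le_integral => //.
- by move=> x _; rewrite lee_fin sqr_ge0.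
- by apply/measurable_EFinP/measurable_funX; exact: measurable_kernel_mean.
- apply: (@measurable_fun_ge0_semidirect _ _ _ _ _ k (fun z => (phi z ^+
    2)%:E)).
    by apply/measurable_EFinP; exact: measurable_funX.
  by move=> z; rewrite lee_fin sqr_ge0.
- move=> x _; have mx : measurable_fun setT (fun y => phi (x, y)).
    exact: measurable_fun_pair2.
  have := jensen_sqr (prob_kernel (s := k) x) 0 mx.
  rewrite subr0 => /le_trans; apply.
  by under eq_integral do rewrite subr0.
Qed.

Lemma fst_L2 (h : X -> R) : h \in Lfun mu 2%:E ->
  (h \o fst) \in Lfun (semidirect mu k) 2%:E.
Proof.
move=> /Lfun2P[mh h2]; apply/Lfun2P; split; first exact: measurableT_comp.
rewrite (@ge0_integral_semidirect_fst _ _ _ _ _ mu k (fun x => (h x ^+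
  2)%:E))//.
  by apply/measurable_EFinP; exact: measurable_funX.
by move=> z; rewrite lee_fin sqr_ge0.
Qed.

(** The conditional mean is the adjoint of the inclusion of the functions of
    x into the functions of (x, y). *)
Lemma integral_kernel_mean (h : X -> R) (phi : X * Y -> R) :
  h \in Lfun mu 2%:E -> phi \in Lfun (semidirect mu k) 2%:E ->
  \int[semidirect mu k]_z (h z.1 * phi z)%:E =
  \int[mu]_x (h x * kernel_mean phi x)%:E.
Proof.
move=> lh lphi.
have ihphi := Lfun2_mul_integrable (fst_L2 lh) lphi.
have [mh _] := (Lfun2P _ _).1 lh; have [mphi phi2] := (Lfun2P _ _).1 lphi.
rewrite integral_semidirect//; apply: ae_eq_integral => //.
- exact: measurable_fun_kernel_integral (measurable_int _ ihphi).
- apply/measurable_EFinP; apply: measurable_funM => //.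
  exact: measurable_kernel_mean.
have : {ae mu, forall x, [set: X] x ->
    \int[k x]_y (phi (x, y) ^+ 2)%:E \is a fin_num}.
  apply: (integrable_ae measurableT).
  have mphi2 : measurable_fun setT (fun z => (phi z ^+ 2)%:E).
    by apply/measurable_EFinP; exact: measurable_funX.
  have phi20 z : 0 <= (phi z ^+ 2)%:E by rewrite lee_fin sqr_ge0.
  apply/integrableP; split.
    exact: (@measurable_fun_ge0_semidirect _ _ _ _ _ k (fun z => (phi z ^+
      2)%:E)).
  under eq_integral do rewrite gee0_abs ?integral_ge0//.
  by rewrite -(ge0_integral_semidirect _ _ mphi2 phi20).
apply: filterS => x /(_ I) finx _ /=.
have iphix : (k x).-integrable setT (fun y => (phi (x, y))%:E).
  apply: (Lfun2_integrable (prob_kernel x)); apply/Lfun2P; split.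
    exact: measurable_fun_pair2.
  by rewrite ltey_eq finx.
under eq_integral do rewrite EFinM.
by rewrite integralZl// EFinM /kernel_mean fineK// integrable_fin_num.
Qed.

End kernel_mean.

(** * The operator of a reversible kernel *)

Section reversible_kernel.
Context d (T : measurableType d) (R : realType).
Variables (mu : probability T R) (K : R.-pker T ~> T).

Definition reversible := forall A, measurable A ->
  semidirect mu K ((fun z : T * T => (z.2, z.1)) @^-1` A) = semidirect mu K A.

Hypothesis rev : reversible.

Let J := semidirect mu K.

Let mswap : measurable_fun [set: T * T] (fun z : T * T => (z.2, z.1)).
Proof. by apply: measurable_fun_pair. Qed.

Lemma ge0_integral_swap (phi : T * T -> \bar R) :
  measurable_fun [set: T * T] phi -> (forall z, 0 <= phi z) ->
  \int[J]_z phi (z.2, z.1) = \int[J]_z phi z.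
Proof.
move=> mphi phi0.
rewrite -(ge0_integral_image_measure J mswap)//.
by apply: eq_measure_integral => A mA _; exact: rev.
Qed.

Lemma integral_swap (phi : T * T -> \bar R) :
  J.-integrable [set: T * T] phi ->
  \int[J]_z phi (z.2, z.1) = \int[J]_z phi z.
Proof.
move=> iphi; have mphi := measurable_int _ iphi.
rewrite [LHS]integralE [RHS]integralE; congr (_ - _).
  rewrite -(@ge0_integral_swap phi^\+)//; last exact: measurable_funepos.
  by apply: eq_integral => z _; rewrite !funeposE.
rewrite -(@ge0_integral_swap phi^\-)//; last exact: measurable_funeneg.
by apply: eq_integral => z _; rewrite !funenegE.
Qed.

Lemma ge0_integral_semidirect_snd (phi : T -> \bar R) :
  measurable_fun [set: T] phi -> (forall x, 0 <= phi x) ->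
  \int[J]_z phi z.2 = \int[mu]_x phi x.
Proof.
move=> mphi phi0; rewrite -(ge0_integral_semidirect_fst mu K)//.
rewrite -(@ge0_integral_swap (fun z => phi z.1))//.
exact: measurableT_comp.
Qed.

Lemma snd_L2 (f : T -> R) : f \in Lfun mu 2%:E -> (f \o snd) \in Lfun J 2%:E.
Proof.
move=> /Lfun2P[mf f2]; apply/Lfun2P; split; first exact: measurableT_comp.
rewrite (@ge0_integral_semidirect_snd (fun x => (f x ^+ 2)%:E))//.
  by apply/measurable_EFinP; exact: measurable_funX.
by move=> z; rewrite lee_fin sqr_ge0.
Qed.

End reversible_kernel.

Section L2.
Context d (T : measurableType d) (R : realType).
Variables (mu : probability T R).

(** Elements are functions, not classes: two almost everywhere equal
    functions differ by a vector of norm zero. *)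
Definition L2 := LfunType mu (lee1n 2).

Definition toL2 (f : T -> R) (fL : f \in Lfun mu 2%:E) : L2 :=
  Lfun_Sub (lee1n 2) fL.

Definition l2ip (u v : L2) : R := fine (\int[mu]_x (u x * v x)%:E).

Lemma l2ipE (u v : L2) : (l2ip u v)%:E = \int[mu]_x (u x * v x)%:E.
Proof.
rewrite fineK// integrable_fin_num//.
exact: Lfun2_mul_integrable (LfunP u) (LfunP v).
Qed.

Lemma l2ip_sym u v : l2ip u v = l2ip v u.
Proof. by congr fine; apply: eq_integral => x _; rewrite mulrC. Qed.

Lemma l2ip_lin a (u v w : L2) :
  l2ip (a *: u + v)%R w = (a * l2ip u w + l2ip v w)%R.
Proof.
apply: EFin_inj; transitivity (a%:E * (l2ip u w)%:E + (l2ip v w)%:E);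
  last by [].
rewrite !l2ipE.
have iu := Lfun2_mul_integrable (LfunP u) (LfunP w).
have iv := Lfun2_mul_integrable (LfunP v) (LfunP w).
rewrite -integralZl// -integralD//; last exact: integrableZl.
by apply: eq_integral => x _; rewrite -EFinM -EFinD /= mulrDl -mulrA.
Qed.

End L2.

Section contraction.
Context d (T : measurableType d) (R : realType).
Variables (mu : probability T R) (K : R.-pker T ~> T).
Hypothesis rev : reversible mu K.

Definition markov_op (u : L2 mu) : L2 mu :=
  toL2 (kernel_mean_L2 (snd_L2 rev (LfunP u))).

Lemma markov_opE (u v : L2 mu) :
  (l2ip u (markov_op v))%:E = \int[semidirect mu K]_z (u z.1 * v z.2)%:E.
Proof. by rewrite l2ipE -integral_kernel_mean ?LfunP// snd_L2 ?LfunP. Qed.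

Let iJ (u v : L2 mu) :
  (semidirect mu K).-integrable setT (fun z => (u z.1 * v z.2)%:E).
Proof.
apply: (Lfun2_mul_integrable (f := u \o fst) (g := v \o snd)).
  exact: fst_L2 (LfunP u).
exact: snd_L2 (LfunP v).
Qed.

Lemma markov_op_sym (u v : L2 mu) : l2ip (markov_op u) v = l2ip u (markov_op v).
Proof.
apply: EFin_inj; rewrite l2ip_sym !markov_opE.
rewrite -(integral_swap rev (iJ v u)).
by apply: eq_integral => z _; rewrite mulrC.
Qed.

(** Both squares expand into the same three terms, and the two marginals of
    the joint law are mu by reversibility. *)
Lemma dirichlet_integral (u : L2 mu) :
  \int[semidirect mu K]_z ((u z.1 - u z.2) ^+ 2)%:E =
  (2 * (l2ip u u - l2ip u (markov_op u)))%:E /\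
  \int[semidirect mu K]_z ((u z.1 + u z.2) ^+ 2)%:E =
  (2 * (l2ip u u + l2ip u (markov_op u)))%:E.
Proof.
have lu := LfunP u; have [mu_ _] := (Lfun2P _ _).1 lu.
have mu2 : measurable_fun setT (fun x => (u x * u x)%:E).
  by apply/measurable_EFinP; exact: measurable_funM.
have u20 x : 0 <= (u x * u x)%:E by rewrite lee_fin -expr2 sqr_ge0.
have e1 : \int[semidirect mu K]_z (u z.1 * u z.1)%:E = (l2ip u u)%:E.
  by rewrite l2ipE (@ge0_integral_semidirect_fst _ _ _ _ _ mu K (fun x => (u x *
    u x)%:E)).
have e2 : \int[semidirect mu K]_z (u z.2 * u z.2)%:E = (l2ip u u)%:E.
  by rewrite l2ipE (@ge0_integral_semidirect_snd _ _ _ _ _ rev (fun x => (u x *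
    u x)%:E)).
have lf := fst_L2 K lu; have ls := snd_L2 rev lu.
have i1 := Lfun2_mul_integrable lf lf; have i2 := Lfun2_mul_integrable ls ls.
have i12 := iJ u u.
have main (s : R) : \int[semidirect mu K]_z
    ((u z.1 * u z.1)%:E + (u z.2 * u z.2)%:E + s%:E * (u z.1 * u z.2)%:E) =
    (2 * l2ip u u + s * l2ip u (markov_op u))%:E.
  rewrite integralD//; [|exact: integrableD|exact: integrableZl].
  rewrite integralD// integralZl// e1 e2 -markov_opE -EFinM -!EFinD.
  by congr EFin; ring.
split.
  rewrite mulrBr -mulNr -main; apply: eq_integral => z _.
  by rewrite -EFinM -!EFinD; congr EFin; ring.
rewrite mulrDr -main; apply: eq_integral => z _.
by rewrite -EFinM -!EFinD; congr EFin; ring.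
Qed.

(** The integrals of the squares of u(x) - u(y) and u(x) + u(y) are
    nonnegative. *)
Lemma markov_op_bound (u : L2 mu) : (`|l2ip u (markov_op u)| <= l2ip u u)%R.
Proof.
have [em ep] := dirichlet_integral u.
have m0 : (0 <= 2 * (l2ip u u - l2ip u (markov_op u)))%R.
  by rewrite -lee_fin -em integral_ge0// => z _; rewrite lee_fin sqr_ge0.
have p0 : (0 <= 2 * (l2ip u u + l2ip u (markov_op u)))%R.
  by rewrite -lee_fin -ep integral_ge0// => z _; rewrite lee_fin sqr_ge0.
by rewrite ler_norml; apply/andP; split; lra.
Qed.

Definition L2_contraction : symContraction R :=
  SymContraction (@l2ip_sym _ _ _ mu) (@l2ip_lin _ _ _ mu)
    markov_op_sym markov_op_bound.

Lemma dirichletE (u : L2_contraction) : (dirichlet u)%:E =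
  2^-1%:E * \int[semidirect mu K]_z (((u : L2 mu) z.1 - (u
    : L2 mu) z.2) ^+ 2)%:E.
Proof.
have [-> _] := dirichlet_integral u; rewrite -EFinM; congr EFin.
by rewrite /dirichlet/= mulKf// pnatr_eq0.
Qed.

End contraction.

(** * Partial sums along the stationary chain *)

Section chain_sums.
Context d (T : measurableType d) (R : realType).
Variables (mu : probability T R) (K : R.-pker T ~> T).

Let ccons n (z : T * n.-tuple T) : n.+1.-tuple T := [tuple of z.1 :: z.2].

Let mccons n : measurable_fun [set: T * n.-tuple T] (@ccons n).
Proof. exact: measurable_cons. Qed.

Lemma ge0_integral_trajectory n x (psi : n.+1.-tuple T -> \bar R) :
  measurable_fun [set: n.+1.-tuple T] psi -> (forall t, 0 <= psi t) ->
  \int[trajectory K n.+1 x]_t psi t =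
  \int[semidirect (K x) (trajectory K n)]_z psi [tuple of z.1 :: z.2].
Proof.
move=> mpsi psi0.
rewrite -(ge0_integral_image_measure (semidirect (K x) (trajectory K n))
  (@mccons n))//.
Qed.

Lemma integral_trajectory n x (psi : n.+1.-tuple T -> \bar R) :
  measurable_fun [set: n.+1.-tuple T] psi ->
  \int[trajectory K n.+1 x]_t psi t =
  \int[semidirect (K x) (trajectory K n)]_z psi [tuple of z.1 :: z.2].
Proof.
move=> mpsi; rewrite [LHS]integralE [RHS]integralE; congr (_ - _).
  rewrite ge0_integral_trajectory//; last exact: measurable_funepos.
  by apply: eq_integral => z _; rewrite !funeposE.
rewrite ge0_integral_trajectory//; last exact: measurable_funeneg.
by apply: eq_integral => z _; rewrite !funenegE.
Qed.

Hypothesis rev : reversible mu K.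

(** By invariance of mu, dropping the initial state of the chain amounts to
    starting it one step later. *)
Lemma ge0_integral_chain_law n (psi : n.+1.-tuple T -> \bar R) :
  measurable_fun [set: n.+1.-tuple T] psi -> (forall t, 0 <= psi t) ->
  \int[chain_law K mu n.+1]_z psi z.2 =
  \int[chain_law K mu n]_z psi [tuple of z.1 :: z.2].
Proof.
move=> mpsi psi0.
have mc : measurable_fun setT (fun z : T * n.-tuple T => psi (ccons z)).
  by apply: measurableT_comp => //; exact: mccons.
rewrite !ge0_integral_semidirect//; last exact: measurableT_comp.
rewrite -[RHS](ge0_integral_semidirect_snd rev); last 2 first.
- exact: (@measurable_fun_ge0_semidirect _ _ _ _ _ (trajectory K n) (fun z =>
    psi (ccons z))).
- by move=> y; exact: integral_ge0.
rewrite [RHS]ge0_integral_semidirect; last 2 first.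
- apply: (@measurableT_comp _ _ _ _ _ _ (fun y => \int[trajectory K n y]_t psi
    (ccons (y, t)))) => //.
  exact: (@measurable_fun_ge0_semidirect _ _ _ _ _ (trajectory K n) (fun z =>
    psi (ccons z))).
- by move=> z; exact: integral_ge0.
apply: eq_integral => x _.
by rewrite ge0_integral_trajectory// ge0_integral_semidirect.
Qed.

Variable F : L2 mu.

Definition path_sum n (t : n.-tuple T) : R := (\sum_(i < n) F (tnth t i))%R.

Lemma path_sum_cons n y (t : n.-tuple T) :
  path_sum [tuple of y :: t] = (F y + path_sum t)%R.
Proof.
rewrite /path_sum big_ord_recl tnth0; congr (_ + _)%R.
by apply: eq_bigr => i _; rewrite tnthS.
Qed.

Lemma measurable_path_sum n : measurable_fun [set: n.-tuple T] (@path_sum n).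
Proof.
apply: measurable_sum => i; apply: measurableT_comp => //.
exact: measurable_tnth.
Qed.

Let step n (z : T * n.-tuple T) : R := (F z.1 + path_sum z.2)%R.

Let step_L2 n : (@path_sum n \o snd) \in Lfun (chain_law K mu n) 2%:E ->
  @step n \in Lfun (chain_law K mu n) 2%:E.
Proof.
have h1 := fst_L2 (trajectory K n) (LfunP F).
by move=> IH; apply: (@rpredD _ _ _ _ h1 IH); rewrite lee1n.
Qed.

Let step_integral n : \int[chain_law K mu n.+1]_z ((path_sum z.2) ^+ 2)%:E =
  \int[chain_law K mu n]_z ((step z) ^+ 2)%:E.
Proof.
rewrite (@ge0_integral_chain_law n (fun t => (path_sum t ^+ 2)%:E));
  last 2 first.
- by apply/measurable_EFinP; apply: measurable_funX; exact: measurable_path_sum.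
- by move=> t; rewrite lee_fin sqr_ge0.
by under eq_integral do rewrite path_sum_cons.
Qed.

(** One more step adds a square integrable term, by the shift of
    [ge0_integral_chain_law]. *)
Lemma path_sum_L2 n : (@path_sum n \o snd) \in Lfun (chain_law K mu n) 2%:E.
Proof.
elim: n => [|n IH].
  rewrite (_ : _ \o _ = cst 0%R); first by exact: Lfun_cst.
  by apply/funext => z; rewrite /path_sum /= big_ord0.
have mS := @measurable_path_sum n.+1.
apply/Lfun2P; split; first exact: measurableT_comp.
by rewrite step_integral; have [] := (Lfun2P _ _).1 (step_L2 IH).
Qed.

(** The conditional mean of the sum F(X_1) + ... + F(X_n) given X_0. *)
Definition mean_path_sum n : L2 mu := toL2 (kernel_mean_L2 (path_sum_L2 n)).

Let mean_step n : L2 mu := toL2 (kernel_mean_L2 (step_L2 (path_sum_L2 n))).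

Lemma l2ip_mean_step n (h : L2 mu) :
  l2ip h (mean_step n) = (l2ip h F + l2ip h (mean_path_sum n))%R.
Proof.
apply: EFin_inj; transitivity ((l2ip h F)%:E + (l2ip h (mean_path_sum n))%:E);
  last by [].
rewrite !l2ipE -!integral_kernel_mean ?LfunP ?path_sum_L2 ?step_L2
  ?path_sum_L2//.
have hL := fst_L2 (trajectory K n) (LfunP h).
have FL := fst_L2 (trajectory K n) (LfunP F).
have -> : \int[mu]_x (h x * F x)%:E =
    \int[semidirect mu (trajectory K n)]_z (h z.1 * (F \o fst) z)%:E.
  rewrite (integral_kernel_mean (LfunP h) FL); apply: eq_integral => x _.
  by rewrite /kernel_mean /= unit_mass_integral_cst// prob_kernel.
have i1 := Lfun2_mul_integrable hL FL.
have i2 := Lfun2_mul_integrable hL (path_sum_L2 n).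
rewrite -integralD//; apply: eq_integral => z _.
by rewrite -EFinD -mulrDr.
Qed.

(** The Markov property at time 1. It holds at each starting point from which
    the sum is square integrable, that is, almost everywhere. *)
Lemma mean_path_sumS n (h : L2 mu) :
  l2ip h (mean_path_sum n.+1) = l2ip h (markov_op rev (mean_step n)).
Proof.
apply: EFin_inj; rewrite !l2ipE.
have mh : measurable_fun setT h by have [] := (Lfun2P _ _).1 (LfunP h).
have mM (u : L2 mu) : measurable_fun setT (fun x => (h x * u x)%:E).
  apply/measurable_EFinP; apply: measurable_funM => //.
apply: ae_eq_integral => //.
have mS := @measurable_path_sum n.+1.
have mS2 : measurable_fun setT (fun t : n.+1.-tuple T => (path_sum t ^+ 2)%:E).
  by apply/measurable_EFinP; exact: measurable_funX.
have S20 (t : n.+1.-tuple T) : 0 <= (path_sum t ^+ 2)%:E by rewrite lee_fin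
  sqr_ge0.
have : {ae mu, forall x, [set: T] x ->
    \int[trajectory K n.+1 x]_t (path_sum t ^+ 2)%:E \is a fin_num}.
  apply: (integrable_ae measurableT); apply/integrableP; split.
    by apply: measurable_fun_integral_kernel => //; exact: measurable_kernel.
  under eq_integral do rewrite gee0_abs ?integral_ge0//.
  have [_] := (Lfun2P _ _).1 (path_sum_L2 n.+1).
  rewrite ge0_integral_semidirect//.
    by apply/measurable_EFinP; apply: measurable_funX; exact: measurableT_comp.
  by move=> z; rewrite lee_fin sqr_ge0.
apply: filterS => x /(_ I) finx _; congr EFin; congr (_ * _)%R.
rewrite /= /kernel_mean /=; congr fine.
rewrite integral_trajectory; last exact/measurable_EFinP.
have stepx : @step n \in Lfun (semidirect (K x) (trajectory K n)) 2%:E.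
  apply/Lfun2P; split; first by have [] :=
    (Lfun2P _ _).1 (step_L2 (path_sum_L2 n)).
  rewrite (eq_integral (fun z : T * n.-tuple T => (path_sum [tuple of z.1 ::
    z.2] ^+ 2)%:E)).
    by rewrite -(@ge0_integral_trajectory n x (fun t => (path_sum t ^+ 2)%:E))//
      ltey_eq finx.
  by move=> z _; rewrite path_sum_cons.
have cstx : cst 1%R \in Lfun (K x) 2%:E.
  apply/Lfun2P; split => //=.
  by rewrite expr1n unit_mass_integral_cst ?prob_kernel// ltry.
transitivity (\int[semidirect (K x) (trajectory K n)]_z (cst 1%R z.1 * step
  z)%:E).
  by apply: eq_integral => z _; rewrite mul1r path_sum_cons.
rewrite (integral_kernel_mean cstx stepx).
by apply: eq_integral => y _; rewrite mul1r.
Qed.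

(** By induction on n: the Markov property and the symmetry of the operator
    turn a step of the chain into an application of the operator to h. *)
Lemma l2ip_mean_path_sum n (h : L2_contraction rev) :
  l2ip h (mean_path_sum n) =
  (\sum_(k < n) @ip _ (L2_contraction rev) F (iter k.+1 (@sym_op _
    (L2_contraction rev)) h))%R.
Proof.
elim: n h => [|n IH] h.
  rewrite big_ord0 /l2ip (_ : \int[mu]__ _ = 0)//.
  apply: integral0_eq => x _ /=; rewrite /kernel_mean /=.
  under eq_integral do rewrite /path_sum big_ord0.
  by rewrite integral0 mulr0.
rewrite mean_path_sumS -(markov_op_sym rev) l2ip_mean_step big_ord_recl/= IH.
congr (_ + _)%R; first exact: l2ip_sym.
by apply: eq_bigr => k _; rewrite -iterSr.
Qed.

(** Going from n to n + 1 steps adds the state X_0 in front of the sum, hence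
    |F|^2 and twice the correlations of lags 1 to n. *)
Lemma chain_law_path_sum_variance n :
  \int[chain_law K mu n]_z ((path_sum z.2) ^+ 2)%:E =
  (@path_sum_variance _ (L2_contraction rev) F n)%:E.
Proof.
elim: n => [|n IH].
  rewrite /path_sum_variance /double_sum big_ord0 mulr0 mul0r subrr.
  by apply: integral0_eq => z _; rewrite /path_sum big_ord0 expr0n.
rewrite step_integral.
have FL := fst_L2 (trajectory K n) (LfunP F).
have i1 := Lfun2_mul_integrable FL FL.
have i2 := Lfun2_mul_integrable FL (path_sum_L2 n).
have i3 := Lfun2_mul_integrable (path_sum_L2 n) (path_sum_L2 n).
rewrite (eq_integral (fun z => ((F \o fst) z * (F \o fst) z)%:E +
  2%:E * ((F \o fst) z * (@path_sum n \o snd) z)%:E +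
  ((@path_sum n \o snd) z * (@path_sum n \o snd) z)%:E)); last first.
  by move=> z _; rewrite /step /= -EFinM -!EFinD; congr EFin; ring.
rewrite integralD//; last by apply: integrableD => //; exact: integrableZl.
rewrite integralD//; last exact: integrableZl.
rewrite integralZl//.
have -> : \int[chain_law K mu n]_z ((F \o fst) z * (F \o fst) z)%:E
  = (l2ip F F)%:E.
  rewrite (integral_kernel_mean (LfunP F) FL) l2ipE; apply: eq_integral => x _.
  by rewrite /kernel_mean /= unit_mass_integral_cst// prob_kernel.
rewrite (integral_kernel_mean (LfunP F) (path_sum_L2 n)) -(l2ipE F
  (mean_path_sum n)).
under [X in _ + X]eq_integral do rewrite -expr2.
rewrite IH l2ip_mean_path_sum -EFinM -!EFinD; congr EFin.
rewrite /path_sum_variance /double_sum big_ord_recr/= -/(double_sum _ n).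
rewrite [in X in (_ = 2 * (_ + X) - _)%R]/partial_sum big_ord_recl
  -[n.+1%:R]natr1.
set c0 := l2ip F F; set D := double_sum _ n.
rewrite (_ : autocorr _ 0 = c0)//.
under [in RHS]eq_bigr do rewrite /autocorr iterS.
by ring.
Qed.

Lemma asymptotic_varianceE (f : T -> R) :
  (forall x, F x = f x - fine 'E_mu[f])%R ->
  asymptotic_variance K mu f = @asymptotic_var _ (L2_contraction rev) F.
Proof.
move=> Ff; rewrite /asymptotic_variance /asymptotic_var; congr (limn _).
apply/funext => n; rewrite EFinM -chain_law_path_sum_variance unlock.
congr (_ * _); apply: eq_integral => z _; congr EFin; congr (_ ^+ 2)%R.
by apply: eq_bigr => i _; rewrite Ff unlock.
Qed.

End chain_sums.

(** * Reversibility of Metropolis-Hastings kernels *)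

Section unit_mass_measure.
Context d (T : measurableType d) (R : realType).

(** An alias of m carrying a probability structure, which the laws k x of a
    probability kernel do not have by themselves. *)
Definition unit_mass_measure (m : {measure set T -> \bar R})
  of m [set: T] = 1 : set T -> \bar R := m.

Variables (m : {measure set T -> \bar R}) (m1 : m [set: T] = 1).

HB.instance Definition _ := Measure.copy (unit_mass_measure m1) m.
HB.instance Definition _ :=
  Measure_isProbability.Build _ _ _ (unit_mass_measure m1) m1.

End unit_mass_measure.

Lemma ge0_integral_exchange d d' (X : measurableType d) (Y : measurableType d')
    (R : realType) (m1 : {measure set X -> \bar R})
    (m2 : {measure set Y -> \bar R}) (f : X * Y -> \bar R) :
  m1 [set: X] = 1 -> m2 [set: Y] = 1 ->
  measurable_fun [set: X * Y] f -> (forall z, 0 <= f z) ->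
  \int[m1]_x \int[m2]_y f (x, y) = \int[m2]_y \int[m1]_x f (x, y).
Proof.
move=> m11 m21 mf f0.
have := @sfinite_Fubini _ _ _ _ _ (unit_mass_measure m11) (unit_mass_measure
  m21) f f0 mf.
by rewrite /unit_mass_measure.
Qed.

Section kernel_precomp.
Context d d' d'' (S : measurableType d) (X : measurableType d')
  (Y : measurableType d'') (R : realType).
Variables (f : S -> X) (k : R.-pker X ~> Y).

(** A kernel read at f(s), for integrands that depend on more parameters than
    the kernel does. *)
Definition kernel_precomp of measurable_fun [set: S] f :
  S -> {measure set Y -> \bar R} := fun s => k (f s).

Variable mf : measurable_fun [set: S] f.

Let measurable_kernel_precomp U : measurable U ->
  measurable_fun [set: S] (kernel_precomp mf ^~ U).
Proof.
by move=> mU; apply: (measurableT_comp (measurable_kernel k U mU) mf).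
Qed.

HB.instance Definition _ :=
  isKernel.Build _ _ _ _ _ (kernel_precomp mf) measurable_kernel_precomp.

Let kernel_precompT s : kernel_precomp mf s [set: Y] = 1.
Proof. exact: prob_kernel. Qed.

HB.instance Definition _ :=
  Kernel_isProbability.Build _ _ _ _ _ (kernel_precomp mf) kernel_precompT.

Lemma measurable_fun_ge0_precomp (phi : S * Y -> \bar R) :
  measurable_fun [set: S * Y] phi -> (forall z, 0 <= phi z) ->
  measurable_fun [set: S] (fun s => \int[k (f s)]_y phi (s, y)).
Proof.
by move=> mphi phi0; exact: (measurable_fun_ge0_semidirect (kernel_precomp mf)).
Qed.

End kernel_precomp.

Section mh_reversible.
Context d (T : measurableType d) (R : realType).
Variables (mu : probability T R) (k : R.-pker T ~> T) (a : acceptance T R).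

Let ma : measurable_fun [set: T * T] (fun z => (a z)%:E).
Proof. by apply/measurable_EFinP; exact: measurable_accept. Qed.

Lemma measurable_rejection : measurable_fun [set: T] (rejection k a).
Proof.
apply: emeasurable_funB => //.
apply: (@measurable_fun_ge0_semidirect _ _ _ _ _ k (fun z => (a z)%:E)) => //.
by move=> z; rewrite lee_fin accept_ge0.
Qed.

(** The moves and the rejections of a Metropolis-Hastings step contribute
    separately. *)
Lemma ge0_integral_mh_flow (phi : T * T -> \bar R) :
  measurable_fun [set: T * T] phi -> (forall z, 0 <= phi z) ->
  \int[semidirect mu (mh_kernel k a)]_z phi z =
  \int[semidirect mu k]_z ((a z)%:E * phi z) +
  \int[mu]_x (rejection k a x * phi (x, x)).
Proof.
move=> mphi phi0.
have aphi0 z : 0 <= (a z)%:E * phi z by rewrite mule_ge0// lee_fin accept_ge0.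
have maphi : measurable_fun setT (fun z => (a z)%:E * phi z).
  exact: emeasurable_funM.
rewrite !ge0_integral_semidirect// -ge0_integralD//.
- apply: eq_integral => x _; rewrite ge0_integral_mh_kernel//.
  exact: measurableT_comp (measurable_pair1 x).
- by move=> x _; apply: integral_ge0.
- exact: (@measurable_fun_ge0_semidirect _ _ _ _ _ k (fun z => (a z)%:E * phi
    z)).
- by move=> x _; rewrite mule_ge0// rejection_ge0.
- apply: emeasurable_funM; first exact: measurable_rejection.
  by apply: (measurableT_comp mphi); exact: measurable_fun_pair.
Qed.

(** Only the accepted moves have to be symmetric, since the rejections stay
    on the diagonal. *)
Lemma mh_reversible :
  (forall phi : T * T -> \bar R, measurable_fun [set: T * T] phi ->
    (forall z, 0 <= phi z) ->
    \int[semidirect mu k]_z ((a z)%:E * phi (z.2, z.1)) =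
    \int[semidirect mu k]_z ((a z)%:E * phi z)) ->
  reversible mu (mh_kernel k a).
Proof.
move=> sym A mA; pose phi (z : T * T) : \bar R := (\1_A z)%:E.
have mphi : measurable_fun setT phi.
  by apply/measurable_EFinP; exact: measurable_indic.
have phi0 z : 0 <= phi z by rewrite lee_fin.
have mswap : measurable_fun setT (fun z : T * T => (z.2, z.1)).
  exact: measurable_fun_pair.
have mA' : measurable ((fun z : T * T => (z.2, z.1)) @^-1` A).
  by rewrite -[X in measurable X]setTI; exact: mswap.
have indE B : measurable B -> semidirect mu (mh_kernel k a) B =
    \int[semidirect mu (mh_kernel k a)]_z (\1_B z)%:E.
  by move=> mB; rewrite integral_indic// setIT.
rewrite !indE//.
rewrite (ge0_integral_mh_flow mphi phi0) -(sym _ mphi phi0).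
rewrite (@ge0_integral_mh_flow (fun z => phi (z.2, z.1)))//.
exact: measurableT_comp.
Qed.

End mh_reversible.

(** Solves measurability goals for tuples built from iterated projections of
    the variable and constants. *)
Ltac measurable_coords :=
  lazymatch goal with
  | |- measurable_fun _ (fun=> ?c) => exact: measurable_cst
  | |- measurable_fun _ (fun x => x) => exact: measurable_id
  | |- measurable_fun _ (fun x => (@?f x, @?g x)) =>
      apply: (@measurable_fun_pair _ _ _ _ _ _ f g); measurable_coords
  | |- measurable_fun _ (fun x => fst (@?f x)) =>
      apply: (measurableT_comp (g := f) measurable_fst); measurable_coords
  | |- measurable_fun _ (fun x => snd (@?f x)) =>
      apply: (measurableT_comp (g := f) measurable_snd); measurable_coords
  end.

Section ratio_swap.
Context d (X : measurableType d) (R : realType).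
Variables (pi : probability X R) (q : R.-pker X ~> X) (r : mh_ratio pi q).

Let mswap : measurable_fun [set: X * X] (fun z : X * X => (z.2, z.1)).
Proof. exact: measurable_fun_pair. Qed.

Let ratio_setE x y : ratio_set r (x, y) <-> ratio_set r (y, x).
Proof. by split; exact: ratio_set_sym. Qed.

(** Exchanging the two states turns the forward flow into the backward flow,
    which has density r with respect to it on the set where the ratio lives.
    This one identity gives the reversibility of both chains. *)
Lemma ge0_integral_ratio_swap (G : X * X -> \bar R) :
  measurable_fun [set: X * X] G -> (forall z, 0 <= G z) ->
  (forall z, ~ ratio_set r z -> G z = 0) ->
  \int[semidirect pi q]_z G (z.2, z.1) =
  \int[semidirect pi q]_z ((r z)%:E * G z).
Proof.
move=> mG G0 Goff; have mS := measurable_ratio_set r.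
have GS : G \_ (ratio_set r) = G.
  apply/funext => z; rewrite patchE; case: ifPn => // /negP zS.
  by rewrite Goff// => zR; apply: zS; rewrite inE.
rewrite -(ge0_integral_image_measure (semidirect pi q) mswap)//.
set beta := image_measure _ _.
transitivity (\int[beta]_(z in ratio_set r) G z).
  by rewrite [RHS]integral_mkcond GS.
rewrite (eq_measure_integral (mrestr beta mS)); last first.
  by move=> A mA AS; rewrite /= /mrestr (setIidl AS).
rewrite [LHS]integral_mkcond GS.
apply: (ge0_integral_density (f := r)) => //.
- exact: measurable_ratio.
- exact: ratio_ge0.
move=> A mA; rewrite /= /mrestr.
have mAS : measurable (A `&` ratio_set r) by exact: measurableI.
have -> : beta (A `&` ratio_set r) =
    \int[semidirect pi q]_(z in A `&` ratio_set r) (r z)%:E.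
  by rewrite -(ratio_density (m := r) mAS)//; exact: subIsetr.
rewrite integral_mkcondr; congr (integral _ _ _); apply/funext => z.
rewrite patchE; case: ifPn => // /negP zS; rewrite ratio_off// => zR.
by apply: zS; rewrite inE.
Qed.

Lemma mul_ratio_min (x y : X) : ratio_set r (x, y) ->
  (r (x, y) * Num.min 1 (r (y, x)) = Num.min 1 (r (x, y)))%R.
Proof.
move=> xyS; have r0 := ratio_gt0 xyS.
by rewrite minr_pMr ?ltW// mulr1 (ratio_inv xyS) minC.
Qed.

(** It comes down to r(x,y) min(1, r(y,x)) = min(1, r(x,y)) on the ratio set. *)
Lemma marginal_reversible : reversible pi (marginal_kernel r).
Proof.
apply: mh_reversible => phi mphi phi0.
have ma : measurable_fun setT (fun z => (marginal_acceptance r z)%:E).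
  by apply/measurable_EFinP; exact: measurable_accept.
pose G (z : X * X) := (marginal_acceptance r (z.2, z.1))%:E * phi z.
transitivity (\int[semidirect pi q]_z G (z.2, z.1)).
  by apply: eq_integral => -[x y] _.
rewrite ge0_integral_ratio_swap.
- apply: eq_integral => -[x y] _ /=; rewrite muleA -EFinM.
  have [xyS|xyS] := pselect (ratio_set r (x, y)).
    by rewrite /marginal_accept mul_ratio_min.
  by rewrite /marginal_accept ratio_off// mul0r minEle ler10.
- apply: emeasurable_funM => //; exact: (measurableT_comp ma mswap).
- by move=> z; rewrite mule_ge0// lee_fin (accept_ge0 (marginal_acceptance r)).
- move=> [x y] xyS; rewrite /G /= /marginal_accept ratio_off ?minEle ?ler10
    ?mul0e//.
  by move=> /ratio_setE.
Qed.

End ratio_swap.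

Section mh_dirichlet.
Context d (T : measurableType d) (R : realType).
Variables (mu : probability T R) (k : R.-pker T ~> T) (a : acceptance T R).
Hypothesis rev : reversible mu (mh_kernel k a).

(** Rejected moves do not change the state, so they do not contribute. *)
Lemma mh_dirichletE (u : L2 mu) :
  (@dirichlet _ (L2_contraction rev) u)%:E = 2^-1%:E *
    \int[semidirect mu k]_z ((a z)%:E * ((u z.1 - u z.2) ^+ 2)%:E).
Proof.
rewrite dirichletE; congr (_ * _).
have [mu_ _] := (Lfun2P _ _).1 (LfunP u).
rewrite (@ge0_integral_mh_flow _ _ _ mu k a (fun z => ((u z.1 - u z.2) ^+
  2)%:E)).
- rewrite [X in _ + X]integral0_eq ?adde0// => x _ /=.
  by rewrite subrr expr0n mule0.
- apply/measurable_EFinP/measurable_funX/measurable_funB.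
    exact: measurableT_comp mu_ measurable_fst.
  exact: measurableT_comp mu_ measurable_snd.
- by move=> z; rewrite lee_fin sqr_ge0.
Qed.

End mh_dirichlet.

Section ratio_null.
Context d (X : measurableType d) (R : realType).
Variables (pi : probability X R) (q : R.-pker X ~> X) (r : mh_ratio pi q).

(** A property that holds for pi-almost every state holds at both ends of
    almost every move in the ratio set. The second end is where the mutual
    absolute continuity of the two flows is needed: without it the law of y
    may charge pi-null sets. *)
Lemma ae_ratio_set (P : X -> Prop) : {ae pi, forall x, P x} ->
  {ae semidirect pi q, forall z, ratio_set r z -> P z.1 /\ P z.2}.
Proof.
move=> [N [mN N0 PN]].
have mfst : measurable ((fst : X * X -> X) @^-1` N).
  by rewrite -[X in measurable X]setTI; exact: measurable_fst.
have msnd : measurable ((snd : X * X -> X) @^-1` N).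
  by rewrite -[X in measurable X]setTI; exact: measurable_snd.
have fst0 : semidirect pi q (fst @^-1` N) = 0.
  have <- : \int[semidirect pi q]_z (\1_(fst @^-1` N) z)%:E =
      semidirect pi q (fst @^-1` N) by rewrite integral_indic// setIT.
  rewrite -N0 -[in RHS](setIT N) -(integral_indic pi measurableT mN).
  apply: (@ge0_integral_semidirect_fst _ _ _ _ _ pi q (fun x => (\1_N x)%:E)) =>
    //.
  by apply/measurable_EFinP; exact: measurable_indic.
pose B := ratio_set r `&` snd @^-1` N.
have mB : measurable B by apply: measurableI => //; exact: measurable_ratio_set.
have B0 : semidirect pi q B = 0.
  apply/(ratio_set_ac mB (@subIsetl _ _ _)).
  rewrite /backward_flow /pushforward.
  apply/eqP; rewrite -measure_le0 -[leRHS]fst0.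
  apply: le_measure; rewrite ?inE//; last by move=> z [].
  rewrite -[X in measurable X]setTI.
  by apply: (@measurable_fun_pair _ _ _ _ _ _ snd fst).
exists (fst @^-1` N `|` B); split.
- exact: measurableU.
- by apply: null_set_setU.
- move=> [x y] /= /not_implyP[xyS] /not_andP[Px|Py]; first by left; exact: PN.
  by right; split => //; exact: PN.
Qed.

End ratio_null.

Section lift.
Context d d' (X : measurableType d) (Y : measurableType d') (R : realType).
Variables (mu : probability X R) (k : R.-pker X ~> Y).

Local Notation joint := (semidirect mu k : probability (X * Y)%type R).

Definition lift (h : L2 mu) : L2 joint := toL2 (fst_L2 k (LfunP h)).

(** The conditional mean, the adjoint of [lift]. *)
Definition condexp (h : L2 joint) : L2 mu := toL2 (kernel_mean_L2 (LfunP h)).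

Lemma lift_adjoint h H : l2ip (lift h) H = l2ip h (condexp H).
Proof.
by apply: EFin_inj; rewrite !l2ipE -integral_kernel_mean ?LfunP.
Qed.

Lemma condexp_lift h : condexp (lift h) = h.
Proof.
apply/LfuneqP => x; rewrite /= /kernel_mean /=.
by rewrite unit_mass_integral_cst// prob_kernel.
Qed.

Lemma lift_isometry h h' : l2ip (lift h) (lift h') = l2ip h h'.
Proof. by rewrite lift_adjoint condexp_lift. Qed.

End lift.

(** * Pseudo-marginal chains *)

Section pseudo_marginal.
Context d (X : measurableType d) (R : realType).
Variables (pi : probability X R) (q : R.-pker X ~> X) (r : mh_ratio pi q).
Variables (W : set R) (Wn0 : W !=set0) (W_ge0 : W `<=` [set w | (0 <= w)%R]).
Variable Q : R.-pker X ~> weight Wn0.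
Hypothesis Q1 : forall x, \int[Q x]_w (wval w)%:E = 1.

Local Notation S := (X * weight Wn0)%type.
Local Notation target := (pm_target pi W_ge0 Q1).
Local Notation proposal := (pm_proposal q Q).

Lemma wval_ge0 (w : weight Wn0) : (0 <= wval w)%R.
Proof. by apply: W_ge0; exact: wvalP. Qed.

Lemma measurable_wvalE : measurable_fun [set: weight Wn0] (fun w => (wval
  w)%:E).
Proof. by apply/measurable_EFinP; exact: measurable_wval. Qed.

Lemma ge0_integral_weighted x (phi : weight Wn0 -> \bar R) :
  measurable_fun [set: weight Wn0] phi -> (forall w, 0 <= phi w) ->
  \int[weighted W_ge0 Q1 x]_w phi w = \int[Q x]_w ((wval w)%:E * phi w).
Proof.
move=> mphi phi0.
apply: (ge0_integral_density (f := @wval _ _ Wn0)) => //.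
- exact: measurable_wval.
- exact: wval_ge0.
Qed.

Lemma ge0_integral_pm_target (phi : S -> \bar R) :
  measurable_fun [set: S] phi -> (forall z, 0 <= phi z) ->
  \int[target]_z phi z =
  \int[pi]_x \int[Q x]_w ((wval w)%:E * phi (x, w)).
Proof.
move=> mphi phi0; rewrite ge0_integral_semidirect//.
apply: eq_integral => x _; rewrite ge0_integral_weighted//.
exact: (measurableT_comp mphi (measurable_pair1 x)).
Qed.

(** The mean of phi over two independent weights, one for each end of a move. *)
Definition weight_pair_integral (phi : S * S -> \bar R) (z : X * X) : \bar R :=
  \int[Q z.1]_w \int[Q z.2]_u phi ((z.1, w), (z.2, u)).

Lemma measurable_weight_pair_integral (phi : S * S -> \bar R) :
  measurable_fun [set: S * S] phi -> (forall z, 0 <= phi z) ->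
  measurable_fun [set: X * X] (weight_pair_integral phi).
Proof.
move=> mphi phi0.
pose phi2 (s : (X * X) * weight Wn0) :=
  \int[Q s.1.2]_u phi ((s.1.1, s.2), (s.1.2, u)).
have mphi2 : measurable_fun setT phi2.
  apply: (@measurable_fun_ge0_precomp _ _ _ _ _ _ _ (fun s
    : (X * X) * weight Wn0 => s.1.2) Q _
    (fun t => phi ((t.1.1.1, t.1.2), (t.1.1.2, t.2)))) => //.
    exact: measurableT_comp.
  apply: (measurableT_comp mphi).
  by measurable_coords.
apply: (@measurable_fun_ge0_precomp _ _ _ _ _ _ _ (fun z : X * X => z.1) Q _
    (fun t => phi2 t)) => //.
  exact: measurable_fst.
by move=> z; apply: integral_ge0 => u _; exact: phi0.
Qed.

Lemma eq_weight_pair_integral (phi psi : S * S -> \bar R) x y :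
  (forall w u, phi ((x, w), (y, u)) = psi ((x, w), (y, u))) ->
  weight_pair_integral phi (x, y) = weight_pair_integral psi (x, y).
Proof.
by move=> e; apply: eq_integral => w _; apply: eq_integral => u _; exact: e.
Qed.

Lemma weight_pair_integral_ge0 (phi : S * S -> \bar R) z :
  (forall z, 0 <= phi z) -> 0 <= weight_pair_integral phi z.
Proof. by move=> phi0; apply: integral_ge0 => w _; exact: integral_ge0. Qed.

(** Tonelli's theorem for the two weights. *)
Lemma weight_pair_integral_swap (phi : S * S -> \bar R) x y :
  measurable_fun [set: S * S] phi -> (forall z, 0 <= phi z) ->
  weight_pair_integral (fun s => phi (s.2, s.1)) (y, x) =
  weight_pair_integral phi (x, y).
Proof.
move=> mphi phi0; rewrite /weight_pair_integral/=.
apply: (@ge0_integral_exchange _ _ _ _ _ (Q y) (Q x)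
  (fun t => phi ((x, t.2), (y, t.1)))) => //; try exact: prob_kernel.
by apply: (measurableT_comp mphi); measurable_coords.
Qed.

Lemma weight_pair_integralZ (c : R) (phi : S * S -> \bar R) x y :
  measurable_fun [set: S * S] phi -> (forall z, 0 <= phi z) -> (0 <= c)%R ->
  weight_pair_integral (fun s => c%:E * phi s) (x, y) =
  c%:E * weight_pair_integral phi (x, y).
Proof.
move=> mphi phi0 c0; rewrite /weight_pair_integral/=.
have mu w : measurable_fun setT (fun u => phi ((x, w), (y, u))).
  by apply: (measurableT_comp mphi); measurable_coords.
rewrite -ge0_integralZl_EFin//.
- by apply: eq_integral => w _; rewrite ge0_integralZl_EFin.
- by move=> w _; exact: integral_ge0.
- apply: (@measurable_fun_ge0_precomp _ _ _ _ _ _ _ (fun=> y) Q _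
    (fun t => phi ((x, t.1), (y, t.2)))) => //.
  by apply: (measurableT_comp mphi); measurable_coords.
Qed.

(** The weight w at the starting point comes from the density of pi_x with
    respect to Q_x. The weight and the proposed state are drawn independently
    given x, hence the two integrals can be exchanged. *)
Lemma ge0_integral_pm_flow (phi : S * S -> \bar R) :
  measurable_fun [set: S * S] phi -> (forall z, 0 <= phi z) ->
  \int[semidirect target proposal]_z phi z =
  \int[semidirect pi q]_z
    weight_pair_integral (fun s => (wval s.1.2)%:E * phi s) z.
Proof.
move=> mphi phi0.
have mphi' : measurable_fun setT (fun s : S * S => (wval s.1.2)%:E * phi s).
  apply: emeasurable_funM => //; apply: (measurableT_comp measurable_wvalE).
  by measurable_coords.
have phi'0 (s : S * S) : 0 <= (wval s.1.2)%:E * phi s.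
  by rewrite mule_ge0// lee_fin wval_ge0.
rewrite ge0_integral_semidirect// ge0_integral_pm_target; last 2 first.
- exact: (measurable_fun_ge0_semidirect proposal).
- by move=> z; exact: integral_ge0.
rewrite ge0_integral_semidirect; last 2 first.
- exact: measurable_weight_pair_integral.
- by move=> z; exact: weight_pair_integral_ge0.
apply: eq_integral => x _.
pose H (t : weight Wn0 * X) :=
  \int[Q t.2]_u ((wval t.1)%:E * phi ((x, t.1), (t.2, u))).
have mH : measurable_fun setT H.
  apply: (@measurable_fun_ge0_precomp _ _ _ _ _ _ _ (fun t
    : weight Wn0 * X => t.2) Q _
    (fun s => (wval s.1.1)%:E * phi ((x, s.1.1), (s.1.2, s.2)))) => //.
    exact: measurable_snd.
    have mc : measurable_fun setT (fun s : (weight Wn0 * X) * weight Wn0 =>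
        (((x, s.1.1), (s.1.2, s.2)) : S * S)) by measurable_coords.
    exact: (measurableT_comp mphi' mc).
  by move=> s; rewrite mule_ge0// lee_fin wval_ge0.
have H0 t : 0 <= H t.
  by apply: integral_ge0 => u _; rewrite mule_ge0// lee_fin wval_ge0.
rewrite -(@ge0_integral_exchange _ _ _ _ _ (Q x) (q x) H)//;
  try exact: prob_kernel.
apply: eq_integral => w _.
have mxw : measurable_fun setT (fun t : S => phi ((x, w), t)).
  exact: (measurableT_comp mphi (measurable_pair1 (x, w))).
rewrite /pm_proposal ge0_integral_semidirect//= -ge0_integralZl_EFin//.
- apply: eq_integral => y _; rewrite /H/= ge0_integralZl_EFin// ?wval_ge0//.
  by apply: (measurableT_comp mphi); measurable_coords.
- by move=> y _; exact: integral_ge0.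
- exact: (@measurable_fun_ge0_semidirect _ _ _ _ _ Q (fun t => phi ((x, w), t))
    mxw).
- exact: wval_ge0.
Qed.

(** The product min(w, r u) of the density w and of the acceptance
    probability; it needs no separate clause for w = 0. *)
Definition pm_rate (s : S * S) : R :=
  Num.min (wval s.1.2) (r (s.1.1, s.2.1) * wval s.2.2)%R.

Lemma pm_rate_ge0 s : (0 <= pm_rate s)%R.
Proof. by rewrite le_min wval_ge0/= mulr_ge0 ?ratio_ge0 ?wval_ge0. Qed.

Lemma measurable_pm_rate : measurable_fun [set: S * S] (fun s => (pm_rate
  s)%:E).
Proof.
apply/measurable_EFinP; apply: measurable_minr.
  by apply: (measurableT_comp (@measurable_wval _ _ Wn0)); measurable_coords.
apply: measurable_funM.
  by apply: (measurableT_comp (measurable_ratio r)); measurable_coords.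
by apply: (measurableT_comp (@measurable_wval _ _ Wn0)); measurable_coords.
Qed.

Lemma pm_rateE s : (wval s.1.2 * pm_acceptance r Wn0 W_ge0 s)%R = pm_rate s.
Proof.
case: s => [[x w] [y u]]; rewrite /= /pm_accept /pm_rate/=.
have w0 := wval_ge0 w; have ru0 : (0 <= r (x, y) * wval u)%R.
  by rewrite mulr_ge0 ?ratio_ge0 ?wval_ge0.
case: ifPn => [/eqP->|wN0]; first by rewrite mul0r minEle ru0.
by rewrite minr_pMr// mulr1; congr Num.min; field.
Qed.

Lemma ge0_integral_pm_accept_flow (phi : S * S -> \bar R) :
  measurable_fun [set: S * S] phi -> (forall z, 0 <= phi z) ->
  \int[semidirect target proposal]_z ((pm_acceptance r Wn0 W_ge0 z)%:E * phi z)
    =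
  \int[semidirect pi q]_z
    weight_pair_integral (fun s => (pm_rate s)%:E * phi s) z.
Proof.
move=> mphi phi0; rewrite ge0_integral_pm_flow.
- apply: eq_integral => -[x y] _; apply: eq_weight_pair_integral => w u.
  by rewrite muleA -EFinM pm_rateE.
- apply: emeasurable_funM => //.
  by apply/measurable_EFinP; exact: measurable_accept.
- by move=> z; rewrite mule_ge0// lee_fin accept_ge0.
Qed.

(** As for the marginal chain, now with r(x,y) min(u, r(y,x) w) = min(w,
    r(x,y) u) on the ratio set; outside of it both rates vanish. *)
Lemma pm_reversible : reversible target (pm_kernel r W_ge0 Q).
Proof.
apply: mh_reversible => phi mphi phi0.
have mphis : measurable_fun setT (fun z : S * S => phi (z.2, z.1)).
  by apply: (measurableT_comp mphi); measurable_coords.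
pose Psi s := (pm_rate s)%:E * phi (s.2, s.1).
transitivity (\int[semidirect pi q]_z weight_pair_integral Psi z).
  exact: (ge0_integral_pm_accept_flow mphis (fun z => phi0 _)).
transitivity (\int[semidirect pi q]_z
    weight_pair_integral (fun s => (pm_rate s)%:E * phi s) z); last first.
  exact/esym/(ge0_integral_pm_accept_flow mphi phi0).
have mPsi : measurable_fun setT Psi.
  by apply: emeasurable_funM => //; exact: measurable_pm_rate.
have Psi0 s : 0 <= Psi s by rewrite mule_ge0// lee_fin pm_rate_ge0.
have rate0 (s : S * S) : ~ ratio_set r (s.1.1, s.2.1) -> pm_rate s = 0%R.
  by move=> sS; rewrite /pm_rate ratio_off// mul0r minEle leNgt;
    case: ltP => //; have := wval_ge0 s.1.2; case: ltgtP.
pose G (z : X * X) := weight_pair_integral Psi (z.2, z.1).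
have mswap : measurable_fun setT (fun z
  : X * X => (z.2, z.1)) by measurable_coords.
have mG : measurable_fun setT G.
  exact: (measurableT_comp (measurable_weight_pair_integral mPsi Psi0) mswap).
have G0 z : 0 <= G z by exact: weight_pair_integral_ge0.
have Goff z : ~ ratio_set r z -> G z = 0.
  case: z => x y xyS; apply: integral0_eq => w _; apply: integral0_eq => u _.
  by rewrite /Psi rate0 ?mul0e//= => /ratio_set_sym.
transitivity (\int[semidirect pi q]_z G (z.2, z.1)).
  by apply: eq_integral => -[x y] _.
transitivity (\int[semidirect pi q]_z ((r z)%:E * G z)).
  exact: (ge0_integral_ratio_swap mG G0 Goff).
apply: eq_integral => -[x y] _; rewrite /G/=.
have mPsis : measurable_fun setT (fun s : S * S => Psi (s.2, s.1)).
  by apply: (measurableT_comp mPsi); measurable_coords.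
have -> : weight_pair_integral Psi (y, x) =
    weight_pair_integral (fun s => Psi (s.2, s.1)) (x, y).
  by rewrite -weight_pair_integral_swap//; exact: eq_weight_pair_integral.
transitivity (weight_pair_integral
    (fun s => (r (x, y))%:E * Psi (s.2, s.1)) (x, y)).
  apply/esym/weight_pair_integralZ => //; exact: ratio_ge0.
apply: eq_weight_pair_integral => w u; rewrite /Psi/= muleA -EFinM.
congr (_%:E * _); have [xyS|xyS] := pselect (ratio_set r (x, y)); last first.
  by rewrite [RHS]rate0//= ratio_off// mul0r.
have r0 := ratio_gt0 xyS; rewrite /pm_rate/= minr_pMr ?ltW// mulrA.
by rewrite (ratio_inv xyS) mul1r minC.
Qed.

Local Notation flow := (semidirect pi q).
Local Notation Lmarg := (L2_contraction (marginal_reversible r)).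
Local Notation Lpm := (L2_contraction (pm_reversible)).

Let mL (h : L2 target) : measurable_fun [set: S] h.
Proof. by have [] := (Lfun2P _ _).1 (LfunP h). Qed.

Let sqdiff (h : L2 target) (s : S * S) : \bar R := ((h s.1 - h s.2) ^+ 2)%:E.

Let msqdiff h : measurable_fun [set: S * S] (sqdiff h).
Proof.
apply/measurable_EFinP/measurable_funX/measurable_funB.
  exact: measurableT_comp (mL h) measurable_fst.
exact: measurableT_comp (mL h) measurable_snd.
Qed.

Let sqdiff_ge0 h s : 0 <= sqdiff h s.
Proof. by rewrite lee_fin sqr_ge0. Qed.

Lemma pm_dirichletE (h : L2 target) :
  (@dirichlet _ Lpm h)%:E = 2^-1%:E *
    \int[flow]_z weight_pair_integral (fun s => (pm_rate s)%:E * sqdiff h s) z.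
Proof.
rewrite mh_dirichletE; congr (_ * _).
exact: (ge0_integral_pm_accept_flow (msqdiff h) (sqdiff_ge0 h)).
Qed.

Local Notation pm_lift := (@lift _ _ _ _ _ pi (weighted W_ge0 Q1)).
Local Notation pm_condexp := (@condexp _ _ _ _ _ pi (weighted W_ge0 Q1)).

Let mwpi (f : S * S -> \bar R) : measurable_fun [set: S * S] f ->
  (forall s, 0 <= f s) ->
  measurable_fun [set: X * X] (weight_pair_integral (fun s => (pm_rate s)%:E * f
    s)).
Proof.
move=> mf f0; apply: measurable_weight_pair_integral.
  by apply: emeasurable_funM => //; exact: measurable_pm_rate.
by move=> z; rewrite mule_ge0// lee_fin pm_rate_ge0.
Qed.

Lemma measurable_inner_weight (f : S * S -> \bar R) x y :
  measurable_fun [set: S * S] f -> (forall s, 0 <= f s) ->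
  measurable_fun [set: weight Wn0] (fun w => \int[Q y]_u f ((x, w), (y, u))).
Proof.
move=> mf f0.
apply: (@measurable_fun_ge0_precomp _ _ _ _ _ _ _ (fun=> y) Q _
    (fun t => f ((x, t.1), (y, t.2)))) => //.
by apply: (measurableT_comp mf); measurable_coords.
Qed.

Lemma measurable_last_weight (f : S * S -> \bar R) s y :
  measurable_fun [set: S * S] f ->
  measurable_fun [set: weight Wn0] (fun u => f (s, (y, u))).
Proof. by move=> mf; apply: (measurableT_comp mf); measurable_coords. Qed.

(** The comparison is only required on a set B of weights of full measure at
    both ends. *)
Lemma le_weight_pair_integral (B : weight Wn0 -> Prop) (f g : S * S
  -> \bar R) x y :
  measurable_fun [set: S * S] f -> (forall s, 0 <= f s) ->
  measurable_fun [set: S * S] g -> (forall s, 0 <= g s) ->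
  {ae Q x, forall w, B w} -> {ae Q y, forall w, B w} ->
  (forall w u, B w -> B u -> f ((x, w), (y, u)) <= g ((x, w), (y, u))) ->
  weight_pair_integral f (x, y) <= weight_pair_integral g (x, y).
Proof.
move=> mf f0 mg g0 Bx By fg; apply: ae_ge0_le_integral => //.
- by move=> w _; exact: integral_ge0.
- exact: measurable_inner_weight.
- by move=> w _; exact: integral_ge0.
- exact: measurable_inner_weight.
apply: filterS Bx => w Bw _; apply: ae_ge0_le_integral => //.
- exact: measurable_last_weight.
- exact: measurable_last_weight.
by apply: filterS By => u Bu _; exact: fg.
Qed.

(** The rate min(w, r u) is at most w and at most r u, and both weights have
    mean 1. *)
Lemma mean_pm_rate_le z :
  weight_pair_integral (fun s => (pm_rate s)%:E) z <= (marginal_accept r z)%:E.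
Proof.
case: z => x y; have mrate := measurable_pm_rate.
have rate0 s : 0 <= (pm_rate s)%:E by rewrite lee_fin pm_rate_ge0.
have mw1 : measurable_fun setT (fun s : S * S => (wval s.1.2)%:E).
  by apply: (measurableT_comp measurable_wvalE); measurable_coords.
have mw2 : measurable_fun setT (fun s : S * S => (wval s.2.2)%:E).
  by apply: (measurableT_comp measurable_wvalE); measurable_coords.
have true_ae x' : {ae Q x', forall w : weight Wn0, True} by exact: aeW.
have rate_le1 : weight_pair_integral (fun s => (pm_rate s)%:E) (x, y) <= 1.
  apply: le_trans (_ : weight_pair_integral (fun s => (wval s.1.2)%:E) (x, y)
    <= _).
    apply: (le_weight_pair_integral (B := fun=> True)) => //.
    - by move=> s; rewrite lee_fin wval_ge0.
    - by move=> w u _ _; rewrite lee_fin /pm_rate ge_min lexx.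
  rewrite -(Q1 x) le_eqVlt; apply/orP; left; apply/eqP.
  by apply: eq_integral => w _; rewrite /= unit_mass_integral_cst// prob_kernel.
have rate_ler : weight_pair_integral (fun s => (pm_rate s)%:E) (x, y)
  <= (r (x, y))%:E.
  have w20 (s : S * S) : 0 <= (wval s.2.2)%:E by rewrite lee_fin wval_ge0.
  have := weight_pair_integralZ x y mw2 w20 (ratio_ge0 r (x, y)).
  have -> : weight_pair_integral (fun s => (wval s.2.2)%:E) (x, y) = 1.
    rewrite /weight_pair_integral/= Q1 unit_mass_integral_cst//.
    exact: prob_kernel.
  rewrite mule1 => <-.
  apply: (le_weight_pair_integral (B := fun=> True)) => //.
  - exact: measurable_funeM.
  - by move=> s; rewrite mule_ge0// lee_fin ?ratio_ge0// wval_ge0.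
  - by move=> w u _ _; rewrite -EFinM lee_fin /pm_rate/= ge_min lexx orbT.
by rewrite /marginal_accept EFin_min le_min rate_le1.
Qed.

Lemma dirichlet_lift_le (h : L2 pi) :
  (@dirichlet _ Lpm (pm_lift h) <= @dirichlet _ Lmarg h)%R.
Proof.
rewrite -lee_fin pm_dirichletE mh_dirichletE lee_pmul2l// ?lte_fin ?invr_gt0//.
have mh : measurable_fun setT h by have [] := (Lfun2P _ _).1 (LfunP h).
apply: ge0_le_integral => //.
- move=> z _; apply: weight_pair_integral_ge0 => s.
  by rewrite mule_ge0 ?sqdiff_ge0// lee_fin pm_rate_ge0.
- exact: mwpi.
- apply: emeasurable_funM; first by apply/measurable_EFinP;
    exact: measurable_accept.
  apply/measurable_EFinP/measurable_funX/measurable_funB.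
    exact: measurableT_comp mh measurable_fst.
  exact: measurableT_comp mh measurable_snd.
move=> -[x y] _.
have c0 : (0 <= (h x - h y) ^+ 2)%R by exact: sqr_ge0.
have rate0 s : 0 <= (pm_rate s)%:E by rewrite lee_fin pm_rate_ge0.
rewrite (eq_weight_pair_integral
  (psi := fun s => ((h x - h y) ^+ 2)%:E * (pm_rate s)%:E)); last first.
  by move=> w u; rewrite muleC.
rewrite (weight_pair_integralZ x y measurable_pm_rate rate0 c0) muleC.
by rewrite lee_wpmul2r// mean_pm_rate_le.
Qed.

Variable wbar : R.
Hypothesis wbar1 : (1 <= wbar)%R.
Hypothesis Q_bounded : {ae pi, forall x : X,
     Q x [set w | (0 <= wval w <= wbar)%R] = 1}.

Let bounded (w : weight Wn0) := (wval w <= wbar)%R.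

Let ae_bounded x : Q x [set w | (0 <= wval w <= wbar)%R] = 1 ->
  {ae Q x, forall w, bounded w}.
Proof.
move=> Qx; exists (~` [set w | (0 <= wval w <= wbar)%R]).
have mB : measurable [set w : weight Wn0 | (0 <= wval w <= wbar)%R].
  rewrite -[X in measurable X]setTI (_ : [set _ | _]
    = @wval _ _ Wn0 @^-1` `[0%R, wbar]).
    by apply: measurable_wval => //; exact: measurable_itv.
  by apply/seteqP; split => w /=; rewrite in_itv.
split; first exact: measurableC.
  pose P := unit_mass_measure (prob_kernel (s := Q) x).
  by have := probability_setC P mB; rewrite /P/unit_mass_measure/= Qx subee.
by move=> w /= nb /andP[_ ?]; exact: nb.
Qed.

(** Jensen's inequality, once for each of the two weights. *)
Lemma condexp_sqr_le (h : L2 target) x y :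
  ((pm_condexp h x - pm_condexp h y) ^+ 2)%:E <=
  weight_pair_integral
    (fun s => (wval s.1.2 * wval s.2.2)%:E * sqdiff h s) (x, y).
Proof.
pose p z : {measure set (weight Wn0) -> \bar R} := weighted W_ge0 Q1 z.
have p1 z : p z setT = 1 by exact: prob_kernel.
have mhz z : measurable_fun setT (fun w => h (z, w)).
  exact: (measurableT_comp (mL h) (measurable_pair1 z)).
pose inner w := \int[p y]_u sqdiff h ((x, w), (y, u)).
have innerE w : inner w = \int[Q y]_u ((wval u)%:E * sqdiff h ((x, w), (y, u))).
  rewrite /inner ge0_integral_weighted//.
  exact: (@measurable_last_weight (sqdiff h) (x, w) y (msqdiff h)).
have minner : measurable_fun setT inner.
  rewrite (_ : inner = fun w => \int[Q y]_u
      ((wval u)%:E * sqdiff h ((x, w), (y, u)))); last exact/funext.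
  apply: (@measurable_inner_weight (fun s => (wval s.2.2)%:E * sqdiff h s)).
    apply: emeasurable_funM => //.
    by apply: (measurableT_comp measurable_wvalE); measurable_coords.
  by move=> s; rewrite mule_ge0 ?sqdiff_ge0// lee_fin wval_ge0.
have inner0 w : 0 <= inner w by apply: integral_ge0 => u _; exact: sqdiff_ge0.
apply: (@le_trans _ _ (\int[p x]_w ((h (x, w) - pm_condexp h y) ^+ 2)%:E)).
  exact: (jensen_sqr (p1 x) (pm_condexp h y) (mhz x)).
apply: (@le_trans _ _ (\int[p x]_w inner w)).
  apply: ge0_le_integral => //.
  - by move=> w _; rewrite lee_fin sqr_ge0.
  - by apply/measurable_EFinP/measurable_funX; apply: measurable_funB.
  - move=> w _; rewrite -sqrrN opprB.
    apply: le_trans (jensen_sqr (p1 y) (h (x, w)) (mhz y)) _.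
    rewrite le_eqVlt; apply/orP; left; apply/eqP; apply: eq_integral => u _.
    by rewrite /sqdiff/= -sqrrN opprB.
rewrite ge0_integral_weighted//.
rewrite le_eqVlt; apply/orP; left; apply/eqP; apply: eq_integral => w _.
have mu : measurable_fun setT (fun u => (wval u)%:E * sqdiff h ((x, w), (y,
  u))).
  apply: emeasurable_funM; first exact: measurable_wvalE.
  exact: (@measurable_last_weight (sqdiff h) (x, w) y (msqdiff h)).
rewrite innerE -ge0_integralZl_EFin ?wval_ge0//.
  by apply: eq_integral => u _; rewrite /= EFinM muleA.
by move=> u _; rewrite mule_ge0 ?sqdiff_ge0// lee_fin wval_ge0.
Qed.

(** Of the two bounds for wbar min(w, r u), the first uses u <= wbar and the
    second w <= wbar. *)
Lemma bounded_rate x y w u : bounded w -> bounded u ->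
  (marginal_accept r (x, y) * (wval w * wval u) <=
   wbar * pm_rate ((x, w), (y, u)))%R.
Proof.
rewrite /bounded /pm_rate /marginal_accept /= => wb ub.
have w0 := wval_ge0 w; have u0 := wval_ge0 u; have r0 := ratio_ge0 r (x, y).
have b0 : (0 <= wbar)%R by apply: le_trans wbar1.
have wu0 : (0 <= wval w * wval u)%R by exact: mulr_ge0.
rewrite minr_pMr// le_min; apply/andP; split.
  apply: (@le_trans _ _ (wval w * wval u)%R).
    by rewrite ler_piMl// ge_min lexx.
  by rewrite mulrC ler_wpM2r.
apply: (@le_trans _ _ (r (x, y) * (wval w * wval u))%R).
  by rewrite ler_wpM2r// ge_min lexx orbT.
rewrite [leLHS]mulrCA ler_wpM2r ?mulr_ge0//.
Qed.

(** On the ratio set both weights are almost surely at most wbar by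
    [ae_ratio_set], and [bounded_rate] applies; outside of it no move of the
    marginal chain is accepted. *)
Lemma dirichlet_condexp_le (h : L2 target) :
  (@dirichlet _ Lmarg (pm_condexp h) <= wbar * @dirichlet _ Lpm h)%R.
Proof.
have b0 : (0 <= wbar)%R by apply: le_trans wbar1.
have mch : measurable_fun setT (pm_condexp h).
  by have [] := (Lfun2P _ _).1 (LfunP (pm_condexp h)).
have rs0 s : 0 <= (pm_rate s)%:E * sqdiff h s.
  by rewrite mule_ge0 ?sqdiff_ge0// lee_fin pm_rate_ge0.
have mrs : measurable_fun setT (fun s => (pm_rate s)%:E * sqdiff h s).
  by apply: emeasurable_funM => //; exact: measurable_pm_rate.
have wpi0 z : 0 <= weight_pair_integral (fun s => (pm_rate s)%:E * sqdiff h s)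
  z.
  exact: weight_pair_integral_ge0.
have mwpi' := mwpi (msqdiff h) (sqdiff_ge0 h).
rewrite -lee_fin EFinM pm_dirichletE mh_dirichletE muleCA.
rewrite lee_pmul2l// ?lte_fin ?invr_gt0// -ge0_integralZl_EFin//.
apply: ae_ge0_le_integral => //.
- by move=> z _; rewrite mule_ge0 ?lee_fin ?sqr_ge0// accept_ge0.
- apply: emeasurable_funM; first by apply/measurable_EFinP;
    exact: measurable_accept.
  apply/measurable_EFinP/measurable_funX/measurable_funB.
    exact: measurableT_comp mch measurable_fst.
  exact: measurableT_comp mch measurable_snd.
- by move=> z _; rewrite mule_ge0.
- exact: measurable_funeM.
apply: filterS (ae_ratio_set r Q_bounded) => -[x y] /= RB _.
have [xyR|xyR] := pselect (ratio_set r (x, y)); last first.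
  by rewrite /marginal_accept ratio_off// minEle ler10 mul0e mule_ge0.
have [/ae_bounded Bx /ae_bounded By] := RB xyR.
have a0 : (0 <= marginal_accept r (x, y))%R by exact: (accept_ge0
  (marginal_acceptance r)).
have mws : measurable_fun setT
    (fun s : S * S => (wval s.1.2 * wval s.2.2)%:E * sqdiff h s).
  apply: emeasurable_funM => //; under eq_fun do rewrite EFinM.
  by apply: emeasurable_funM;
    apply: (measurableT_comp measurable_wvalE); measurable_coords.
have ws0 (s : S * S) : 0 <= (wval s.1.2 * wval s.2.2)%:E * sqdiff h s.
  by rewrite mule_ge0 ?sqdiff_ge0// lee_fin mulr_ge0// wval_ge0.
apply: le_trans (lee_wpmul2l _ (condexp_sqr_le h x y)) _;
  first by rewrite lee_fin.
rewrite -(weight_pair_integralZ x y mws ws0 a0).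
rewrite -(weight_pair_integralZ x y mrs rs0 b0).
apply: (le_weight_pair_integral (B := bounded)) => //.
- exact: measurable_funeM.
- by move=> s; apply: mule_ge0; [rewrite lee_fin|exact: ws0].
- exact: measurable_funeM.
- by move=> s; apply: mule_ge0; [rewrite lee_fin|exact: rs0].
move=> w u wb ub; rewrite !muleA; apply: lee_wpmul2r; first exact: sqdiff_ge0.
by rewrite -!EFinM lee_fin; exact: bounded_rate.
Qed.

(** As the lift is an isometry and the adjoint of the conditional mean, the
    squared norm of the latter is <lift (condexp h), h>. *)
Lemma condexp_norm_le (h : L2 target) :
  (l2ip (pm_condexp h) (pm_condexp h) <= l2ip h h)%R.
Proof.
have := @ip_amgm _ Lpm (pm_lift (pm_condexp h)) h.
rewrite /= lift_adjoint lift_isometry => /(le_trans (ler_norm _)); lra.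
Qed.

Variables (g : X -> R).
Hypothesis gL : g \in Lfun pi 2%:E.

Let m := fine 'E_pi[g].

Let g0L : (fun x => g x - m)%R \in Lfun pi 2%:E.
Proof.
have h2 : cst (- m)%R \in Lfun pi 2%:E by exact: Lfun_cst.
by apply: (@rpredD _ _ _ _ gL h2); rewrite lee1n.
Qed.

Let g0 : L2 pi := toL2 g0L.

Let mean_lift : 'E_target[g \o fst] = 'E_pi[g].
Proof.
rewrite unlock.
have c1 : cst 1%R \in Lfun pi 2%:E by exact: Lfun_cst.
transitivity (\int[target]_z (cst 1%R z.1 * (g \o fst) z)%:E).
  by apply: eq_integral => z _; rewrite mul1r.
rewrite (integral_kernel_mean c1 (fst_L2 (weighted W_ge0 Q1) gL)).
apply: eq_integral => x _; rewrite mul1r; congr EFin.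
exact: (congr1 (fun f : L2 pi => f x)
  (condexp_lift (weighted W_ge0 Q1) (toL2 gL))).
Qed.

Let var_g0 : 'V_pi[g] = (l2ip g0 g0)%:E.
Proof.
rewrite l2ipE /variance !unlock; apply: eq_integral => x _ /=.
by rewrite /m unlock.
Qed.

(** The comparison principle with the lift, from the marginal chain, and with
    the conditional mean, from the pseudo-marginal one. *)
Lemma pm_variance_bounds :
  asymptotic_variance (marginal_kernel r) pi g <=
    asymptotic_variance (pm_kernel r W_ge0 Q) target (g \o fst) /\
  asymptotic_variance (pm_kernel r W_ge0 Q) target (g \o fst) <=
    wbar%:E * asymptotic_variance (marginal_kernel r) pi g +
    (wbar - 1)%:E * 'V_pi[g].
Proof.
rewrite (asymptotic_varianceE (marginal_reversible r) (F := g0))//.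
rewrite (asymptotic_varianceE (pm_reversible) (F := pm_lift g0)); last first.
  by move=> z; rewrite mean_lift.
have iso := lift_isometry (weighted W_ge0 Q1).
split.
  apply: (@asymptotic_var_monotone _ Lmarg Lpm (fun h => pm_lift h)).
  - by move=> h; exact: iso.
  - by move=> h; exact: iso.
  - exact: dirichlet_lift_le.
  - by rewrite /= iso.
rewrite var_g0.
apply: (@asymptotic_var_comparison _ Lpm Lmarg (fun h => pm_condexp h) (pm_lift
  g0) g0 wbar) => //.
- by move=> h; rewrite /= l2ip_sym -lift_adjoint l2ip_sym.
- move=> h; apply: le_trans (condexp_norm_le h) _.
  by rewrite ler_peMl// (ip_ge0 (h : Lpm)).
- exact: dirichlet_condexp_le.
- exact: iso.
Qed.

End pseudo_marginal.

Unset Implicit Arguments.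
Set Strict Implicit.
Set Printing Implicit Defensive.

Theorem corollary11 (R : realType) (d : measure_display) (X : measurableType d)
  (pi : probability X R) (q : R.-pker X ~> X) (r : mh_ratio pi q)
  (W : set R) (mW : measurable W) (W_neq0 : W !=set0)
  (W_ge0 : W `<=` [set w | (0 <= w)%R])
  (Q : R.-pker X ~> weight W_neq0)
  (Q_mean1 : forall x : X, \int[Q x]_w (wval w)%:E = 1)
  (gap_gt0 : 0 < gap (marginal_kernel r) pi)
  (wbar : R) (wbar_ge1 : (1 <= wbar)%R)
  (Q_bounded : {ae pi, forall x : X,
     Q x [set w | (0 <= wval w <= wbar)%R] = 1})
  (g : X -> R) (mg : measurable_fun [set: X] g)
  (g2 : 'E_pi[fun x => (g x ^+ 2)%R] < +oo) :
  let P := marginal_kernel r in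
  let P_pm := pm_kernel r W_ge0 Q in
  let pi_pm := pm_target pi W_ge0 Q_mean1 in
  let g_pm := fun z : X * weight W_neq0 => g z.1 in
  asymptotic_variance P pi g <= asymptotic_variance P_pm pi_pm g_pm /\
  asymptotic_variance P_pm pi_pm g_pm <=
    wbar%:E * asymptotic_variance P pi g + (wbar - 1)%:E * 'V_pi[g].
Proof.
move=> P P_pm pi_pm g_pm.
have gL : g \in Lfun pi 2%:E by apply/Lfun2P; split=> //; rewrite unlock in g2.
exact: (pm_variance_bounds r W_ge0 Q_mean1 wbar_ge1 Q_bounded gL).
Qed.
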